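(* Every neighborly simplicial $3$-sphere $K$ has the toric lifting property; that is, every mod $2$ characteristic map $\lambda^{\mathbb R}\colon V(K)\to\mathbb Z_2^4$ over $K$ admits a lift.
   Context: $\mathbb Z_2=\mathbb Z/2\mathbb Z$. A simplicial $3$-sphere is a (finite, abstract) simplicial complex whose geometric realization is homeomorphic to $S^3$. $V(K)$ is the vertex set of $K$; facets are maximal simplices. $K$ is neighborly if every pair of distinct vertices of $K$ spans an edge of $K$. A mod $2$ characteristic map over $K$ is a map $\lambda^{\mathbb R}\colon V(K)\to\mathbb Z_2^4$ such that the images of the four vertices of every facet form a basis of $\mathbb Z_2^4$. An integral characteristic map over $K$ is a map $\lambda\colon V(K)\to\mathbb Z^4$ such that the images of the four vertices of every facet form a basis of $\mathbb Z^4$. A lift of $\lambda^{\mathbb R}$ is an integral characteristic map $\lambda$ over $K$ with $\lambda(v)\equiv\lambda^{\mathbb R}(v)\pmod 2$ for every vertex $v$. $K$ has the toric lifting property if every mod $2$ characteristic map over $K$ admits a lift. *)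

(* Defs.v *)
From HB Require Import structures.
From mathcomp Require Import all_boot all_order all_algebra.
From mathcomp Require Import all_classical all_reals all_analysis.
Import Order.TTheory GRing.Theory Num.Theory.
Import numFieldNormedType.Exports.
Local Open Scope classical_set_scope.
Local Open Scope ring_scope.

(* The maps are total on the ambient spaces; only their restrictions to A and
   B matter. *)
Definition homeomorphic {X Y : topologicalType} (A : set X) (B : set Y) : Prop :=
  exists (f : X -> Y) (g : Y -> X),
    [/\ f @` A `<=` B, g @` B `<=` A,
        {in A, cancel f g}, {in B, cancel g f}
      & {within A, continuous f} /\ {within B, continuous g}].

(* The topology of 'rV[R]_4 comes from the sup norm, hence is the usual one. *)
Definition sphere3 (R : realType) : set 'rV[R]_4 :=
  [set x | \sum_(i < 4) x 0 i ^+ 2 = 1].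

Section Complexes.
Context {T : finType}.
Implicit Types (K : {set {set T}}) (F : {set T}).

(* Elements of T need not be vertices of K.  The empty face belongs to every
   nonvoid complex. *)
Definition simplicial_complex K : Prop :=
  forall F G : {set T}, F \in K -> G \subset F -> G \in K.

Definition vertices K : {set T} := [set v | [set v]%SET \in K]%SET.

Definition facet K F : bool := maxset [in K] F.

(* Barycentric coordinates, with support a simplex of K. *)
Definition realization (R : realType) K : set {ptws T -> R} :=
  [set x | [/\ forall v, 0 <= x v, \sum_v x v = 1
             & [set v | x v != 0]%SET \in K]].

Definition simplicial_3sphere (R : realType) K : Prop :=
  simplicial_complex K /\ homeomorphic (realization R K) (sphere3 R).

Definition neighborly K : Prop :=
  {in vertices K &, forall v w, v != w -> [set v; w]%SET \in K}.

End Complexes.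

Section CharacteristicMaps.
Context {T : finType}.

(* The family (e v) indexed by v in F is a basis of the free A-module A^n. *)
Definition family_basis {A : comNzRingType} {n : nat} (F : {set T})
    (e : T -> 'rV[A]_n) : Prop :=
  (forall c : T -> A, \sum_(v in F) c v *: e v = 0 -> {in F, forall v, c v = 0})
  /\ (forall w : 'rV[A]_n, exists c : T -> A, w = \sum_(v in F) c v *: e v).

(* Maps on the vertex set are represented by functions on T, whose values off
   the vertex set are irrelevant.  A facet must have four vertices for its
   image to be a basis, since A has the invariant basis number property. *)
Definition characteristic_map {A : comNzRingType} (K : {set {set T}})
    (lambda : T -> 'rV[A]_4) : Prop :=
  forall F : {set T}, facet K F -> family_basis F lambda.

Definition mod2_characteristic_map (K : {set {set T}})
    (lambdaR : T -> 'rV['F_2]_4) : Prop :=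
  characteristic_map K lambdaR.

Definition integral_characteristic_map (K : {set {set T}})
    (lambda : T -> 'rV[int]_4) : Prop :=
  characteristic_map K lambda.

Definition lift_of (K : {set {set T}}) (lambdaR : T -> 'rV['F_2]_4)
    (lambda : T -> 'rV[int]_4) : Prop :=
  integral_characteristic_map K lambda /\
  {in vertices K, forall v, map_mx intr (lambda v) = lambdaR v}.

Definition toric_lifting_property (K : {set {set T}}) : Prop :=
  forall lambdaR : T -> 'rV['F_2]_4, mod2_characteristic_map K lambdaR ->
    exists lambda : T -> 'rV[int]_4, lift_of K lambdaR lambda.

End CharacteristicMaps.

(* Main.v *)
From HB Require Import structures.
Require Import Defs.
From mathcomp Require Import all_boot all_order all_algebra all_fingroup.
From mathcomp Require Import all_classical all_reals all_analysis.
From mathcomp Require Import ring lra zify.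
(* Names shared by sets and finite sets denote the notions on finite sets. *)
From mathcomp Require Import fintype finset.

(** Let f_i be the number of i-dimensional faces of K.  The theorem follows from
    f_3 <= 166, and neighborliness gives f_3 <= 90.

    Why few facets suffice ([lift_of_few_facets]).  For M in GL_4(F_2), lift the
    entries of all the vectors lambdaR(v) M to the integers 0 and 1, and multiply
    by the inverse of the 0/1 lift of M.  This is a lift of lambdaR provided that
    the 0/1 lifts of M and of the matrices P_F M are unimodular, where the rows of
    P_F are the values of lambdaR on the facet F.  Only 120 of the 20160 elements
    of GL_4(F_2) have a 0/1 lift of determinant other than 1 and -1
    ([card_nonunimodular]), so f_3 + 1 conditions can be met together as soon as
    120 (f_3 + 1) < 20160.

    Why neighborly spheres have few facets.  The values of lambdaR are nonzero,
    and distinct since any two vertices lie in a common facet; hence f_0 <= 15.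
    For a triangulated 3-sphere f_3 = f_1 - f_0, which is at most 105 - 15 = 90
    ([card_facets_bound]).

    Why f_3 = f_1 - f_0.  This is a consequence of the vanishing of the Euler
    characteristic and of the fact that each triangle lies in two facets.  They
    say, for s a facet and for s a triangle, that the antistar of s, the faces not
    containing s, has as many faces of even as of odd size, the empty face
    included ([antistar_parity]).  This holds because the antistar is a retract
    of the full simplex on T ([antistar_retract]): it is a retract of the
    realization of K minus the barycenter of s, which is a punctured sphere, hence
    a euclidean space, to which Tietze's theorem applies.  A retract of a simplex
    is acyclic ([fine_labelling_acyclic], [retract_parity]): subdivide the cone
    over a cycle so finely that the retraction, rounded to the vertices, is
    simplicial; its image is a chain of the antistar, and its boundary is the
    cycle by Sperner's lemma. *)

Set Implicit Arguments. Unset Strict Implicit. Unset Printing Implicit Defensive.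
Import Order.TTheory GRing.Theory Num.Theory.
Import numFieldNormedType.Exports.
Local Open Scope ring_scope.

(** * Ordered simplices and barycentric subdivision *)

Section Deletions.
Context {P : Type}.

(** The lists obtained by deleting one entry are the terms of the boundary of
    an ordered simplex; modulo 2 no signs are needed. *)
Fixpoint deletions (s : seq P) : seq (seq P) :=
  if s is x :: s' then s' :: [seq x :: t | t <- deletions s'] else [::].

Fixpoint subdivide_rec (b : seq P -> P) (n : nat) (s : seq P) : seq (seq P) :=
  if n is n'.+1 then
    flatten [seq [seq b s :: w | w <- subdivide_rec b n' t] | t <- deletions s]
  else [:: [::]].

(** A cell of the barycentric subdivision is the barycenter [b s] of the whole
    list followed by a cell of the subdivision of one of its facets. *)
Definition subdivide (b : seq P -> P) (s : seq P) := subdivide_rec b (size s) s.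

Fixpoint subdivide_iter (b : seq P -> P) (k : nat) (s : seq P) : seq (seq P) :=
  if k is k'.+1 then flatten [seq subdivide_iter b k' w | w <- subdivide b s] else [:: s].

Context {V : zmodType} (V2 : forall x : V, x + x = 0).
Variable b : seq P -> P.

(** The functional [G] stands for an arbitrary linear map on ordered
    simplices, so this says that the boundary of the boundary is 0: any two
    entries can be deleted in two orders. *)
Lemma deletions_deletions (G : seq P -> V) s :
  \sum_(t <- deletions s) \sum_(u <- deletions t) G u = 0.
Proof.
elim: s G => [|x s IH] G /=; first by rewrite big_nil.
rewrite big_cons big_map.
under [X in _ + X]eq_bigr do rewrite /= big_cons big_map.
by rewrite big_split /= IH addr0 V2.
Qed.

End Deletions.

Section DeletionsMembers.
Context {P : eqType}.

Lemma size_deletions (s t : seq P) : t \in deletions s -> (size t).+1 = size s.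
Proof.
elim: s t => [|x s IH] t //=; rewrite inE => /orP[/eqP-> //|].
by case/mapP=> u /IH us -> /=; rewrite us.
Qed.

Lemma mem_deletions (s t : seq P) : t \in deletions s -> {subset t <= s}.
Proof.
elim: s t => [|x s IH] t //=; rewrite inE => /orP[/eqP-> y ys|].
  by rewrite inE ys orbT.
case/mapP=> u /IH us -> y; rewrite !inE => /orP[->//|/us ->].
by rewrite orbT.
Qed.

Lemma deletions_rem (s : seq P) : uniq s -> deletions s = [seq rem x s | x <- s].
Proof.
elim: s => [|x s IH] //= /andP[xs us]; rewrite eqxx IH //; congr cons.
rewrite -map_comp; apply/eq_in_map => y ys /=.
by case: eqP => // xy; rewrite xy ys in xs.
Qed.

End DeletionsMembers.

Section Subdivision.
Context {P : eqType} (b : seq P -> P).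

Lemma subdivide_nil : subdivide b [::] = [:: [::]]. Proof. by []. Qed.

Lemma subdivide_neq0 s : s != [::] ->
  subdivide b s = flatten [seq [seq b s :: w | w <- subdivide b t] | t <- deletions s].
Proof.
case: s => // x s _; have -> : subdivide b (x :: s) = flatten
  [seq [seq b (x :: s) :: w | w <- subdivide_rec b (size s) t] | t <- deletions (x :: s)] by [].
congr flatten; apply/eq_in_map => t /size_deletions[].
by rewrite /subdivide => ->.
Qed.

(** Subdivision is a chain map. Deleting the leading barycenter of a cell
    leaves a cell of the subdivided boundary; the deletions of other entries
    cancel, since by induction they form the cone over the subdivision of the
    boundary of the boundary. *)
Lemma subdivide_deletions {V : zmodType} (V2 : forall x : V, x + x = 0)
    (G : seq P -> V) s :
  \sum_(w <- subdivide b s) \sum_(t <- deletions w) G t =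
  \sum_(t <- deletions s) \sum_(w <- subdivide b t) G w.
Proof.
have [n] := ubnP (size s); elim: n s G => // n IH s G ltsn.
have [->|s0] := eqVneq s [::]; first by rewrite subdivide_nil big_seq1 /= !big_nil.
rewrite subdivide_neq0 // big_flatten big_map.
transitivity (\sum_(t <- deletions s) (\sum_(w <- subdivide b t) G w +
    \sum_(u <- deletions t) \sum_(w <- subdivide b u) G (b s :: w))).
  rewrite big_seq [RHS]big_seq; apply: eq_bigr => t st; rewrite big_map /=.
  rewrite -(IH t (fun w => G (b s :: w))) ?(size_deletions st) // -big_split.
  by apply: eq_bigr => w _; rewrite big_cons big_map.
by rewrite big_split /= (deletions_deletions V2 (fun u => \sum_(w <- subdivide b u) G (b s :: w))) addr0.
Qed.

Lemma subdivide_iter_deletions {V : zmodType} (V2 : forall x : V, x + x = 0) k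
    (G : seq P -> V) s :
  \sum_(w <- subdivide_iter b k s) \sum_(t <- deletions w) G t =
  \sum_(t <- deletions s) \sum_(w <- subdivide_iter b k t) G w.
Proof.
elim: k s => [|k IH] s /=.
  by rewrite big_seq1; apply: eq_bigr => t _; rewrite big_seq1.
rewrite big_flatten big_map /=.
under eq_bigr do rewrite IH.
rewrite (subdivide_deletions V2 (fun t => \sum_(w <- subdivide_iter b k t) G w)).
by apply: eq_bigr => t _; rewrite big_flatten big_map.
Qed.

Lemma size_subdivide s w : w \in subdivide b s -> size w = size s.
Proof.
have [n] := ubnP (size s); elim: n s w => // n IH s w ltsn.
have [->|s0] := eqVneq s [::]; first by rewrite subdivide_nil inE => /eqP->.
rewrite subdivide_neq0 // => /flatten_mapP[t st /mapP[u /IH us -> /=]].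
by rewrite us ?(size_deletions st).
Qed.

Lemma size_subdivide_iter k s w : w \in subdivide_iter b k s -> size w = size s.
Proof.
elim: k s => [|k IH] s /=; first by rewrite inE => /eqP->.
by case/flatten_mapP=> u /size_subdivide <- /IH.
Qed.

End Subdivision.

(** * Simplicial chains modulo 2 *)

Section Chains.
Context {T : finType}.
Implicit Types (A B : {set T}) (L : {set {set T}}).

Notation chain := {ffun {set T} -> ('F_2)^o}.
Implicit Types c : chain.

Lemma chainDD c : c + c = 0.
Proof. by apply/ffunP=> A; rewrite !ffunE addrr_pchar2 // pchar_Fp. Qed.

Definition supported L c := forall A, c A != 0 -> A \in L.

(** A chain may mix simplices of different dimensions, and the empty set
    counts as a simplex, so that homology is reduced. *)
Definition simplex A : chain := [ffun B => (B == A)%:R].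

Definition boundary c : chain :=
  [ffun B : {set T} => \sum_(a | a \notin B) c (a |: B)].

(** On a simplex A this is the simplex x |: A, or 0 when x already belongs to
    A. *)
Definition cone x c : chain :=
  [ffun B : {set T} => if x \in B then c (B :\ x) else 0].

Lemma boundary_linear : linear boundary.
Proof.
move=> k c d; apply/ffunP=> B; rewrite !ffunE scaler_sumr -big_split /=.
by apply: eq_bigr => a _; rewrite !ffunE.
Qed.
HB.instance Definition _ := GRing.isLinear.Build _ _ _ _ boundary boundary_linear.

Lemma cone_linear x : linear (cone x).
Proof.
move=> k c d; apply/ffunP=> B; rewrite !ffunE.
by case: ifP; rewrite ?ffunE // scaler0 addr0.
Qed.
HB.instance Definition _ x := GRing.isLinear.Build _ _ _ _ (cone x) (cone_linear x).

(** The cone formula holds without exception: if x belongs to A, the terms A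
    and x |: (A :\ x) cancel. *)
Lemma boundary_cone x c : boundary (cone x c) = c + cone x (boundary c).
Proof.
apply/ffunP=> B; rewrite !ffunE; case: ifPn => xB.
  rewrite [X in _ + X](bigD1 x) /= ?setD11 // setD1K // addrA.
  rewrite addrr_pchar2 ?pchar_Fp // add0r; apply: eq_big => [a|a aB].
    by rewrite !inE; case: (eqVneq a x) => [->|]; rewrite ?xB ?andbT ?andbF.
  rewrite ffunE !inE xB orbT setDUl; congr (c (_ :|: _)).
  apply/setP=> y; rewrite !inE; case: (eqVneq y a) => [->|]; rewrite ?andbF //.
  by rewrite andbT; apply: contraNneq aB => ->.
rewrite (bigD1 x) //= ffunE setU11 big1 ?addr0 => [|a /andP[aB ax]].
  by rewrite setU1K.
by rewrite ffunE !inE eq_sym (negPf ax) (negPf xB).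
Qed.

(** An ordered simplex as a chain, with value 0 as soon as an entry is
    repeated; a labelling of points may identify the vertices of a cell. *)
Definition wedge (s : seq T) : chain := foldr cone (simplex set0) s.

Lemma boundary_wedge s : boundary (wedge s) = \sum_(t <- deletions s) wedge t.
Proof.
elim: s => [|x s IH] /=.
  rewrite big_nil; apply/ffunP=> B; rewrite !ffunE big1 // => a _.
  by rewrite ffunE; case: eqP => // /setP/(_ a); rewrite !inE eqxx.
by rewrite boundary_cone IH big_cons big_map raddf_sum.
Qed.

Lemma wedge_neq0 s A : wedge s A != 0 -> A = [set x in s] /\ #|A| = size s.
Proof.
elim: s A => [|x s IH] A /=; rewrite ffunE.
  case: (eqVneq A set0) => [-> _|]; rewrite ?eqxx // cards0.
  by split=> //; apply/setP=> y; rewrite !inE.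
case: ifP => // xA /IH[eA cA]; split.
  by rewrite -(setD1K xA) eA; apply/setP=> y; rewrite !inE.
by rewrite (cardsD1 x) xA cA.
Qed.

Lemma wedge_simplex s : uniq s -> wedge s = simplex [set x in s].
Proof.
elim: s => [|x s IH] /=; first by move=> _; congr simplex; apply/setP=> y; rewrite !inE.
case/andP=> xs /IH->; apply/ffunP=> B; rewrite !ffunE.
have xs' : x \notin [set y in s] by rewrite inE.
case: ifPn => xB.
  congr (_ : bool)%:R; rewrite set_cons; apply/eqP/eqP => [<-|->].
    by rewrite setD1K.
  by rewrite setU1K.
by case: eqP => // eB; rewrite eB !inE eqxx in xB.
Qed.

Lemma simplex_sum c : c = \sum_A c A *: simplex A.
Proof.
apply/ffunP=> B; rewrite sum_ffunE (bigD1 B) //= big1 => [|A AB].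
  by rewrite addr0 !ffunE eqxx; apply/esym/mulr1.
by rewrite !ffunE eq_sym (negPf AB) scaler0.
Qed.

Lemma boundary_simplex A : boundary (simplex A) = \sum_(a in A) simplex (A :\ a).
Proof.
have eA : A = [set x in enum A] by apply/setP=> x; rewrite inE mem_enum.
rewrite {1}eA -wedge_simplex ?enum_uniq // boundary_wedge deletions_rem ?enum_uniq //.
rewrite big_map big_enum /=; apply: eq_bigr => a aA.
rewrite wedge_simplex ?rem_uniq ?enum_uniq //; congr simplex.
by apply/setP=> x; rewrite !inE rem_filter ?enum_uniq // mem_filter mem_enum.
Qed.

Lemma boundary_boundary c : boundary (boundary c) = 0.
Proof.
rewrite [c]simplex_sum !linear_sum big1 // => A _.
have eA : A = [set x in enum A] by apply/setP=> x; rewrite inE mem_enum.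
rewrite !linearZ /= eA -wedge_simplex ?enum_uniq // boundary_wedge raddf_sum /=.
under eq_bigr do rewrite boundary_wedge.
by rewrite (deletions_deletions chainDD) scaler0.
Qed.

End Chains.

(** * A combinatorial criterion for acyclicity *)

Section Acyclic.
Context {T : finType} {P : eqType} (L : {set {set T}}).
Variables (b : seq P -> P) (e : T -> P) (phi : P -> T) (k : nat) (o : T).
Hypothesis L_sub : simplicial_complex L.
Hypothesis phi_carrier : forall A w x, A \in L ->
  w \in subdivide_iter b k (map e (enum A)) -> x \in w -> phi x \in A.
Hypothesis phi_small : forall s w, (size s <= #|T|.+1)%N -> w \in subdivide_iter b k (map e s) ->
  [set x in map phi w] \in L.

Notation chain := {ffun {set T} -> ('F_2)^o}.
Let label (s : seq T) : chain :=
  \sum_(w <- subdivide_iter b k (map e s)) wedge (map phi w).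

Lemma map_deletions {P1 P2 : Type} (f : P1 -> P2) s :
  deletions (map f s) = [seq map f t | t <- deletions s].
Proof.
elim: s => //= x s ->; congr cons.
by rewrite -!map_comp; apply: eq_map.
Qed.

Lemma boundary_label s : boundary (label s) = \sum_(t <- deletions s) label t.
Proof.
rewrite /label raddf_sum /=.
under eq_bigr do rewrite boundary_wedge map_deletions big_map.
by rewrite (subdivide_iter_deletions b chainDD k (fun w => wedge (map phi w))) map_deletions big_map.
Qed.

Lemma supported_label s : (size s <= #|T|.+1)%N -> supported L (label s).
Proof.
move=> sT A; rewrite sum_ffunE; apply: contraNT => nAL.
rewrite big_seq big1 // => w /(phi_small sT) wL; apply/eqP.
by apply: contraNT nAL => /wedge_neq0[->].
Qed.

Lemma enum_remE (A : {set T}) a : a \in A -> rem a (enum A) = enum (A :\ a).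
Proof.
move=> aA; rewrite rem_filter ?enum_uniq // {1}/enum_mem -filter_predI.
by apply: eq_filter => x; rewrite !inE.
Qed.

Lemma deletions_enum (A : {set T}) : deletions (enum A) = [seq enum (A :\ a) | a <- enum A].
Proof.
rewrite deletions_rem ?enum_uniq //; apply/eq_in_map => a.
by rewrite mem_enum => /enum_remE.
Qed.

(** Sperner's lemma: the labels of the cells of A lie in A, so the subdivided
    simplex is mapped to a multiple of A, and comparing boundaries shows by
    induction that the factor is 1. *)
Lemma label_simplex A : A \in L -> label (enum A) = simplex A.
Proof.
have [n] := ubnP #|A|; elim: n A => // n IH A; rewrite ltnS => leAn AL.
have [A0|[a aA]] := set_0Vmem A.
  have sd0 : forall j, subdivide_iter b j [::] = [:: [::]] by elim=> //= j ->.
  by rewrite /label A0 enum_set0 /= sd0 big_seq1.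
have supA B : label (enum A) B != 0 -> B = A.
  rewrite sum_ffunE; apply: contraNeq => nBA.
  rewrite big_seq big1 // => w wA; apply/eqP.
  apply: contraNT nBA => /wedge_neq0[eB]; rewrite size_map (size_subdivide_iter wA) size_map.
  rewrite -cardE => cB; rewrite eqEcard cB leqnn andbT.
  by rewrite eB; apply/subsetP=> y; rewrite inE => /mapP[x xw ->]; apply: phi_carrier xw.
have bdA : boundary (label (enum A)) = boundary (simplex A).
  rewrite boundary_label deletions_enum big_map boundary_simplex big_enum /=.
  apply: eq_bigr => x xA; apply: IH; last exact: L_sub AL (subsetDl _ _).
  by rewrite (leq_trans _ leAn) // [X in (_ < X)%N](cardsD1 x) xA.
(* Both chains are multiples of the simplex on A, and the coefficient of A is
   that of the face opposite to a in the boundary. *)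
have := congr1 (fun c : chain => c (A :\ a)) bdA; rewrite !ffunE.
rewrite (bigD1 a) ?setD11 //= big1 ?addr0; last first.
  move=> x /andP[xA xa]; apply/eqP; apply: contraNT xa => /supA/setP/(_ x).
  by move: xA; rewrite !inE eqxx negb_and negbK /= => /orP[//|xA]; rewrite (negPf xA).
rewrite [RHS](bigD1 a) ?setD11 //= big1 ?addr0; last first.
  move=> x /andP[xA xa]; rewrite ffunE; case: eqP => // /setP/(_ x).
  by move: xA; rewrite !inE eqxx negb_and negbK (negPf xa) /= => xA; rewrite (negPf xA).
rewrite setD1K // => eA; apply/ffunP=> B.
have [->//|nBA] := eqVneq B A.
by rewrite [RHS]ffunE (negPf nBA); apply/eqP; apply: contraNT nBA => /supA->.
Qed.

(** A labelling of the points of the full simplex which respects the faces of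
    L, and which sends every cell of a fine subdivision to a face of L, turns
    the cone over a cycle into a chain of L that bounds the cycle. *)
Lemma fine_labelling_acyclic (z : chain) : supported L z -> boundary z = 0 ->
  exists2 y : chain, supported L y & boundary y = z.
Proof.
(* The image of the cone over z with apex o.  Its boundary is z plus the image
   of the cone over the boundary of z; o may be a vertex of A, as repeated
   entries are harmless in ordered simplices. *)
move=> supz bz; exists (\sum_A z A *: label (o :: enum A)).
  move=> A; rewrite sum_ffunE; apply: contraNT => nAL; rewrite big1 // => B _.
  rewrite ffunE; have [->|] := eqVneq (label (o :: enum B) A) 0; first by rewrite scaler0.
  have sz : (size (o :: enum B) <= #|T|.+1)%N by rewrite /= -cardE ltnS max_card.
  by move/(supported_label sz); rewrite (negPf nAL).
rewrite linear_sum /=.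
under eq_bigr => A _.
  rewrite linearZ /= boundary_label /= big_cons scalerDr big_map deletions_enum big_map.
  rewrite big_enum /=.
  over.
rewrite big_split /= -[RHS]addr0; congr (_ + _).
  rewrite [RHS]simplex_sum; apply: eq_bigr => A _.
  have [->|/supz AL] := eqVneq (z A) 0; first by rewrite !scale0r.
  by rewrite label_simplex.
under eq_bigr do rewrite scaler_sumr.
transitivity (\sum_B boundary z B *: label (o :: enum B)); last first.
  by apply: big1 => B _; rewrite bz ffunE scale0r.
under [RHS]eq_bigr do rewrite ffunE scaler_suml.
rewrite (exchange_big_dep xpredT) //= [RHS](exchange_big_dep xpredT) //=.
apply: eq_bigr => a _.
rewrite (reindex_onto (fun B => a |: B) (fun A => A :\ a)) /=; last first.
  by move=> A aA; rewrite setD1K.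
apply: eq_big => B; last by case/andP=> _ /eqP->.
rewrite setU11 /=; apply/eqP/idP => [<-|]; first by rewrite setD11.
by move=> aB; rewrite setU1K.
Qed.
End Acyclic.

(** * Acyclic complexes have as many even as odd faces *)

Section Euler.
Context {T : finType}.
Notation chain := {ffun {set T} -> ('F_2)^o}.
Implicit Types (L : {set {set T}}) (X : {set chain}).

Definition chains_on L : {set chain} := [set c : chain | [forall A, (c A != 0) ==> (A \in L)]].

Lemma chains_onP L c : reflect (supported L c) (c \in chains_on L).
Proof. by rewrite inE; apply: (iffP forallP) => h A; apply/implyP/h. Qed.

Lemma card_chains_on L : #|chains_on L| = (2 ^ #|L|)%N.
Proof.
have <- : #|pffun_on (0 : ('F_2)^o) [in L] predT| = (2 ^ #|L|)%N.
  by rewrite card_pffun_on card_Fp.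
apply: eq_card => c; apply/chains_onP/pffun_onP => [h|[h _]].
  by split=> //; apply/subsetP.
by move=> A cA; apply: (subsetP h); rewrite inE.
Qed.

Lemma chains_onB L c d : c \in chains_on L -> d \in chains_on L -> c - d \in chains_on L.
Proof.
move=> /chains_onP cL /chains_onP dL; apply/chains_onP => A.
rewrite !ffunE; apply: contraNT => AL.
have -> : c A = 0 by apply/eqP; apply: contraNT AL => /cL.
have -> : d A = 0 by apply/eqP; apply: contraNT AL => /dL.
by rewrite subr0.
Qed.

(** The rank-nullity theorem for the boundary, by counting: its nonempty
    fibres in X are translates of the kernel. *)
Lemma card_cycles_boundaries X :
  {in X &, forall c d, c - d \in X} ->
  #|X| = (#|[set c in X | boundary c == 0%R]| * #|boundary @: X|)%N.
Proof.
move=> XB.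
have XD : {in X &, forall c d, c + d \in X}.
  by move=> c d cX dX; rewrite -[d]opprK -[- d]sub0r !XB // -(subrr d) XB.
rewrite -sum1_card (partition_big_imset boundary) /= mulnC -sum_nat_const.
apply: eq_bigr => _ /imsetP[x xX ->].
rewrite sum1dep_card -[RHS](card_imset _ (addrI x)).
apply: eq_card => y; rewrite !inE; apply/andP/imsetP => [[yX /eqP fy]|[z]].
  by exists (y - x); [rewrite inE XB // raddfB /= fy subrr | rewrite addrC subrK].
by rewrite inE => /andP[zX /eqP fz] ->; rewrite XD // raddfD /= fz addr0.
Qed.

Definition faces_of_parity L p := [set A in L | odd #|A| == p].

Lemma boundary_parity L p c :
  simplicial_complex L ->
  supported (faces_of_parity L p) c ->
  supported (faces_of_parity L (~~ p)) (boundary c).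
Proof.
move=> L_sub cL B; rewrite ffunE; apply: contraNT => BL.
apply/eqP; apply: big1 => a aB; apply/eqP; apply: contraNT BL => /cL.
rewrite !inE => /andP[aL]; rewrite cardsU1 aB /= => /eqP<-.
by rewrite negbK eqxx (L_sub _ _ aL) // subsetUr.
Qed.

(** Exactness says that the boundary maps even chains onto odd cycles and odd
    chains onto even cycles. By rank-nullity both spaces of chains have the
    size of (even cycles) x (odd cycles). *)
Lemma acyclic_parity L :
  simplicial_complex L ->
  (forall z, supported L z -> boundary z = 0 ->
     exists2 y, supported L y & boundary y = z) ->
  #|faces_of_parity L true| = #|faces_of_parity L false|.
Proof.
move=> L_sub L_acyc.
have cyc p : boundary @: chains_on (faces_of_parity L (~~ p)) =
    [set c in chains_on (faces_of_parity L p) | boundary c == 0%R].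
  apply/setP=> z; apply/imsetP/idP => [[y /chains_onP yL ->]|].
    rewrite inE; apply/andP; split.
      by apply/chains_onP; rewrite -[p]negbK; apply: boundary_parity.
    by rewrite boundary_boundary.
  rewrite inE => /andP[/chains_onP zL /eqP bz].
  have [|y yL yz] := L_acyc z _ bz.
    by move=> A /zL; rewrite inE => /andP[].
  (* Only the faces of y of the right parity contribute to z. *)
  exists [ffun A : {set T} => if odd #|A| == ~~ p then y A else 0].
    apply/chains_onP => A; rewrite ffunE; case: ifP; rewrite ?eqxx // => pA /yL.
    by rewrite inE pA andbT.
  apply/ffunP => B; rewrite -yz !ffunE.
  case: (eqVneq (odd #|B|) p) => pB.
    by apply: eq_bigr => a aB; rewrite ffunE cardsU1 aB /= pB eqxx.
  rewrite [RHS]big1 => [|a aB]; last first.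
    by rewrite ffunE cardsU1 aB /= (inj_eq negb_inj) (negPf pB).
  have := congr1 (fun c : chain => c B) yz; rewrite ffunE => ->.
  apply/eqP; apply: contraNT pB => /zL; rewrite inE.
  by case/andP.
have h p := card_cycles_boundaries (@chains_onB (faces_of_parity L p)).
have /eqP : #|chains_on (faces_of_parity L true)| =
            #|chains_on (faces_of_parity L false)|.
  by rewrite (h true) (h false) -(cyc true) -(cyc false) mulnC.
by rewrite !card_chains_on eqn_exp2l // => /eqP.
Qed.

End Euler.

(** * Counting the facets *)

Section Count.
Local Open Scope nat_scope.
Context {T : finType} (K : {set {set T}}).
Hypothesis K_sub : simplicial_complex K.
Hypothesis K_pure : forall A, A \in K -> exists2 F, F \in K & A \subset F /\ #|F| = 4.

(** These are the faces of dimension k - 1; counting vertices includes the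
    empty face, of size 0. *)
Definition faces_of_size k := [set A in K | #|A| == k].
Definition star (s : {set T}) := [set A in K | s \subset A].
Definition antistar (s : {set T}) := [set A in K | ~~ (s \subset A)].

Lemma antistar_complex s : simplicial_complex (antistar s).
Proof.
move=> F G; rewrite !inE => /andP[FK nsF] GF; rewrite (K_sub FK GF) /=.
by apply: contra nsF => /subset_trans; exact.
Qed.

Hypothesis K_antistar : forall s, s \in K -> s != set0 ->
  #|faces_of_parity (antistar s) true| = #|faces_of_parity (antistar s) false|.

Lemma card_parity_antistar s p : #|faces_of_parity K p| =
  (#|faces_of_parity (star s) p| + #|faces_of_parity (antistar s) p|)%N.
Proof.
rewrite -(cardsID (star s)); congr (_ + _)%N; apply: eq_card => A; rewrite !inE.
  by case: (A \in K) => //=; rewrite andbC.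
by case: (A \in K) => //=.
Qed.

Lemma size_face (A : {set T}) : A \in K -> #|A| <= 4.
Proof. by case/K_pure=> F _ [/subset_leq_card AF <-]. Qed.

Lemma maximal_face (F A : {set T}) : #|F| = 4 -> A \in K -> F \subset A -> A = F.
Proof.
by move=> F4 /size_face A4 FA; apply/esym/eqP; rewrite eqEcard FA F4.
Qed.

(** The star of a facet consists of that facet only. As the empty face is
    counted, this is the vanishing of the Euler characteristic of K. *)
Lemma euler_facet (F : {set T}) : F \in K -> #|F| = 4 ->
  #|faces_of_parity K false| = #|faces_of_parity K true|.+1.
Proof.
move=> FK F4; have F0 : F != set0 by apply: contra_eq_neq F4 => ->; rewrite cards0.
rewrite !(card_parity_antistar F) K_antistar //.
have -> : faces_of_parity (star F) false = [set F].
  apply/setP=> A; rewrite !inE; apply/idP/eqP => [/andP[/andP[AK FA] _]|->].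
    exact: maximal_face.
  by rewrite FK subxx F4.
have -> : faces_of_parity (star F) true = set0.
  apply/setP=> A; rewrite !inE; apply/negP => /andP[/andP[AK FA]].
  by rewrite (maximal_face F4 AK FA) F4.
by rewrite cards1 cards0.
Qed.

(** This is how being a pseudomanifold without boundary follows from Euler
    characteristics alone. *)
Lemma two_facets_per_triangle (s : {set T}) : s \in K -> #|s| = 3 ->
  #|[set F in faces_of_size 4 | s \subset F]| = 2.
Proof.
move=> sK s3; have s0 : s != set0 by apply: contra_eq_neq s3 => ->; rewrite cards0.
have [F FK [_ F4]] := K_pure sK.
(* The star of s consists of s and of the facets containing it, so the excess
   of even over odd faces is the number of these facets minus one. *)
have := euler_facet FK F4; rewrite !(card_parity_antistar s) K_antistar //.
have -> : faces_of_parity (star s) true = [set s].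
  apply/setP=> A; rewrite !inE; apply/idP/eqP => [/andP[/andP[AK sA] oA]|->].
    apply/esym/eqP; rewrite eqEcard sA s3 /=.
    by have := size_face AK; move: oA; case: #|A| => [|[|[|[|[]]]]].
  by rewrite sK subxx s3.
have -> : faces_of_parity (star s) false = [set F in faces_of_size 4 | s \subset F].
  apply/setP=> A; rewrite !inE -andbA [RHS]andbAC -andbA.
  case AK: (A \in K) => //=; case sA: (s \subset A) => //=.
  have := size_face AK; have := subset_leq_card sA; rewrite s3.
  by case: #|A| => [|[|[|[|[]]]]].
rewrite cards1; lia.
Qed.

Lemma faces_in_face (F : {set T}) k : F \in K ->
  #|[set s in faces_of_size k | s \subset F]| = 'C(#|F|, k).
Proof.
move=> FK; rewrite -cards_draws; apply: eq_card => A; rewrite !inE.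
case AF: (A \subset F); rewrite ?andbF //= andbT.
by rewrite (K_sub FK AF).
Qed.

Lemma four_facets_two_triangles : 4 * #|faces_of_size 4| = 2 * #|faces_of_size 3|.
Proof.
rewrite mulnC [RHS]mulnC -!sum_nat_const.
transitivity (\sum_(F in faces_of_size 4) \sum_(s in faces_of_size 3 | s \subset F) 1).
  apply: eq_bigr => F; rewrite inE => /andP[FK /eqP F4].
  have := faces_in_face 3 FK; rewrite F4 -sum1_card => e; rewrite -[LHS]/('C(4, 3)) -e.
  by apply: eq_bigl => s; rewrite inE.
rewrite (exchange_big_dep (mem (faces_of_size 3))) /=; last by move=> ? ? _ /andP[].
apply: eq_bigr => s s3; have := s3; rewrite inE => /andP[sK /eqP ss].
rewrite -[RHS](two_facets_per_triangle sK ss) -[RHS]sum1_card.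
by apply: eq_bigl => F; rewrite !inE sK ss.
Qed.

Lemma card_faces_le4 p : #|faces_of_parity K p| =
  \sum_(k < 5) (if odd k == p then #|faces_of_size k| else 0).
Proof.
rewrite -big_mkcond /=.
rewrite -sum1_card (partition_big (fun A : {set T} => inord #|A| : 'I_5) (fun k : 'I_5 => odd k == p)) /=.
  apply: eq_bigr => k kp; rewrite -sum1_card; apply: eq_bigl => A.
  rewrite !inE; case AK: (A \in K) => //=.
  rewrite -val_eqE /= inordK ?ltnS ?size_face //.
  by case: (eqVneq #|A| k) => [->|]; rewrite ?kp ?andbF.
by move=> A; rewrite inE => /andP[AK]; rewrite inordK ?ltnS ?size_face.
Qed.

(** Here 2 f_2 = 4 f_3, by counting incidences, reduces the Euler relation to
    f_3 = f_1 - f_0. *)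
Lemma card_facets : K != set0 ->
  #|faces_of_size 4| + #|faces_of_size 1| = #|faces_of_size 2|.
Proof.
case/set0Pn=> A AK; have [F FK [_ F4]] := K_pure AK.
have := euler_facet FK F4; have := four_facets_two_triangles.
have : #|faces_of_size 0| = 1.
  rewrite -(cards1 (set0 : {set T})); apply: eq_card => B; rewrite !inE cards_eq0.
  by case: eqP => [->|]; rewrite ?andbF // (K_sub AK) ?sub0set.
rewrite !card_faces_le4 !big_ord_recl !big_ord0 /= /bump /= !addn0 !add1n; lia.
Qed.

Lemma card_facets_bound : K != set0 -> #|faces_of_size 1| <= 15 ->
  #|faces_of_size 4| <= 90.
Proof.
move=> K0 m15; have := card_facets K0.
have : #|faces_of_size 2| <= 'C(#|faces_of_size 1|, 2).
  have -> : #|faces_of_size 1| = #|[set v | [set v] \in K]|.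
    rewrite -[RHS](card_imset _ set1_inj); apply: eq_card => A; rewrite !inE.
    apply/andP/imsetP => [[AK /cards1P[v eA]]|[v + ->]].
      by exists v; rewrite // inE -eA.
    by rewrite inE cards1.
  rewrite -cards_draws; apply/subset_leq_card/subsetP => A.
  rewrite !inE => /andP[AK ->]; rewrite andbT.
  by apply/subsetP=> v vA; rewrite inE (K_sub AK) // sub1set.
move: #|faces_of_size 1| #|faces_of_size 2| #|faces_of_size 4| m15 => m e f.
rewrite bin2; by do 16?[case: m => [|m] /=; first lia]; lia.
Qed.
End Count.

(** * Continuity and compactness *)

Section Continuity.
Local Open Scope classical_set_scope.
Local Open Scope ring_scope.

Lemma continuous_ptws (R : realType) (T : finType) (X : topologicalType)
    (F : X -> {ptws T -> R}) :
  (forall v, continuous (fun x => F x v)) -> continuous F.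
Proof.
move=> cF x; apply/cvg_sup => v; apply/cvg_image.
  by rewrite classical_sets.eqEsubset; split=> y // _; exists (fun=> y).
move=> W Wx; exists ((fun h : {ptws T -> R} => h v) @^-1` W).
  exact: cF Wx.
rewrite classical_sets.eqEsubset; split=> [y [h hW <-]//|y Wy].
by exists (fun=> y).
Qed.

Lemma continuous_mx (R : realType) (X : topologicalType) m n
    (F : X -> 'M[R]_(m, n)) :
  (forall i j, continuous (fun x => F x i j)) -> continuous F.
Proof.
move=> cF x A [P PF PA]; rewrite /= nbhs_simpl /=.
suff h : \forall y \near x, forall i j, P i j (F y i j).
  by apply: filterS h => y Py; apply: PA.
apply: filter_forall => i; apply: filter_forall => j.
exact: (cF i j x _ (PF i j)).
Qed.

Lemma continuous_sum (R : realType) (X : topologicalType) (I : finType)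
    (P : pred I) (F : I -> X -> R) :
  (forall i, P i -> continuous (F i)) ->
  continuous (fun x => \sum_(i | P i) F i x).
Proof. by move=> cF; apply: continuous_big => //; exact: add_continuous. Qed.

Lemma continuous_bigmin (R : realType) (X : topologicalType) (I : finType)
    (P : pred I) (a : R) (F : I -> X -> R) :
  (forall i, P i -> continuous (F i)) ->
  continuous (fun x => \big[Num.min/a]_(i | P i) F i x).
Proof.
move=> cF; apply: continuous_big => // x.
apply: continuous_min; [exact: cvg_fst|exact: cvg_snd].
Qed.

Lemma within_continuous_comp (X Y Z : topologicalType) (A : set X) (B : set Y)
    (h : X -> Y) (g : Y -> Z) :
  continuous h -> (forall x, A x -> B (h x)) -> {within B, continuous g} ->
  {within A, continuous (g \o h)}.
Proof.
move=> ch hB /subspace_continuousP cg; apply/subspace_continuousP => x Ax.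
apply: (@cvg_comp _ _ _ h g _ (within B (nbhs (h x)))); last by apply: cg; exact: hB.
move=> W /= WB; apply: (@filterS _ (nbhs x) _ _ _ _ (ch x _ WB)) => y /= BW Ay.
by apply: BW; exact: hB.
Qed.

(** The composite is continuous everywhere although g is controlled on B only,
    because h takes its values in B. *)
Lemma continuous_within_comp (X Y Z : topologicalType) (B : set Y)
    (h : X -> Y) (g : Y -> Z) :
  continuous h -> (forall x, B (h x)) -> {within B, continuous g} ->
  continuous (g \o h).
Proof.
move=> ch hB cg; apply/continuous_subspace_setT.
exact: (within_continuous_comp ch _ cg).
Qed.

(** A single modulus of continuity serves the finitely many functions F v. *)
Lemma uniform_continuity (R : realType) N (A : set 'rV[R]_N) (I : finType)
    (F : I -> 'rV[R]_N -> R) :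
  compact A -> (forall v, continuous (F v)) -> forall e : R, 0 < e ->
  exists2 d : R, 0 < d & forall (x y : 'rV[R]_N) v, A x -> (forall i, `|x 0 i - y 0 i| < d) ->
    `|F v x - F v y| < e.
Proof.
move=> /compact_near_coveringP cA cF e e0.
pose P v d (x : 'rV[R]_N) := forall y : 'rV[R]_N, (forall i, `|x 0 i - y 0 i| < d) -> `|F v x - F v y| < e.
have near0 v : \forall d \near 0^'+, A `<=` P v d.
  apply: cA => x Ax.
  have e2 : 0 < e / 2 by rewrite divr_gt0.
  have /nbhs_ballP[r /= r0 rF] : \forall y \near x, `|F v x - F v y| < e / 2.
    by move/cvgrPdist_lt: (cF v x); apply.
  have r2 : 0 < r / 2 by rewrite divr_gt0.
  exists (ball x (r / 2), [set d | d < r / 2]) => /=.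
    by split; [exact: nbhsx_ballx|exact: nbhs_right_lt].
  move=> [x' d] /= [[_ xx'] dr] y yd.
  have h1 : `|F v x - F v x'| < e / 2.
    apply: rF; split=> // i j; apply: lt_trans (xx' i j) _.
    by rewrite gtr_pMr // invf_lt1 ?ltr1n.
  have h2 : `|F v x - F v y| < e / 2.
    apply: rF; split=> // i j; rewrite (splitr r).
    apply: le_lt_trans (ler_distD (x' i j) _ _) _.
    apply: ltrD; first exact: xx'.
    by rewrite (ord1 i); apply: lt_trans (yd j) _.
  rewrite (splitr e); apply: le_lt_trans (ler_distD (F v x) _ _) _.
  by apply: ltrD => //; rewrite distrC.
near (0 : R)^'+ => d.
exists d; first by near: d; exact: nbhs_right_gt.
have AP : forall v, A `<=` P v d by near: d; exact: filter_forall.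
by move=> x y v /AP; apply.
Unshelve. all: by end_near. Qed.

Lemma cvg_sum (R : realType) (X : Type) (F : set_system X) (FF : Filter F)
    (I : finType) (f : I -> X -> R) (l : I -> R) :
  (forall i, f i x @[x --> F] --> l i) -> \sum_i f i x @[x --> F] --> \sum_i l i.
Proof. by move=> cf; apply: cvg_big => //; exact: add_continuous. Qed.

End Continuity.

(** * The punctured sphere as an absolute extensor *)

Section Sphere.
Local Open Scope classical_set_scope.
Local Open Scope ring_scope.
Context {R : realType}.
Implicit Types a b q : 'rV[R]_4.

Definition dot a b : R := \sum_(i < 4) a 0 i * b 0 i.

Lemma dotC a b : dot a b = dot b a.
Proof. by apply: eq_bigr => i _; rewrite mulrC. Qed.

Lemma dotDl a b c : dot (a + b) c = dot a c + dot b c.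
Proof. by rewrite -big_split; apply: eq_bigr => i _; rewrite mxE mulrDl. Qed.

Lemma dotZl k a b : dot (k *: a) b = k * dot a b.
Proof. by rewrite mulr_sumr; apply: eq_bigr => i _; rewrite mxE mulrA. Qed.

Lemma dotBl a b c : dot (a - b) c = dot a c - dot b c.
Proof. by rewrite dotDl -scaleN1r dotZl mulN1r. Qed.

Lemma sphere3E a : sphere3 R a <-> dot a a = 1.
Proof.
by split; rewrite /sphere3 /= /dot => <-; apply: eq_bigr => i _; rewrite expr2.
Qed.

Lemma dot_gt0 a : a != 0 -> 0 < dot a a.
Proof.
move=> a0; rewrite lt0r sumr_ge0 ?andbT => [|i _]; last by rewrite -expr2 sqr_ge0.
apply: contraNneq a0 => /eqP; rewrite psumr_eq0 => [/allP h|i _]; last by rewrite -expr2 sqr_ge0.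
apply/eqP/rowP=> i; rewrite mxE; have := h i (mem_index_enum _).
by rewrite mulf_eq0 orbb => /eqP.
Qed.

Lemma dot_sub_sphere a q : dot a a = 1 -> dot q q = 1 ->
  dot (a - q) (a - q) = 2 * (1 - dot a q).
Proof.
move=> a1 q1; rewrite dotBl ![dot _ (a - _)]dotC !dotBl.
by rewrite a1 q1 [dot q a]dotC; ring.
Qed.

(** The stereographic projection from q, up to translation: its image lies in
    the affine hyperplane of the vectors w with [dot w q = -1]. *)
Definition stereo q a : 'rV[R]_4 := (1 - dot a q)^-1 *: (a - q).

(** The second intersection with the sphere of the line through q directed by
    the orthogonal projection w' of w to the hyperplane [dot w q = -1].
    Projecting first makes it defined for every w. *)
Definition unstereo q (w : 'rV[R]_4) : 'rV[R]_4 :=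
  let w' := w - (dot w q + 1) *: q in q + (2 / dot w' w') *: w'.

Lemma unstereo_proj_neq0 q w : dot q q = 1 -> w - (dot w q + 1) *: q != 0.
Proof.
move=> q1; apply/eqP => /(congr1 (fun w => dot w q)).
have -> : dot 0 q = 0 by apply: big1 => i _; rewrite mxE mul0r.
rewrite dotBl dotZl q1 => e.
have /eqP : (-1 : R) = 0 by rewrite -[RHS]e; ring.
by rewrite oppr_eq0 oner_eq0.
Qed.

Lemma unstereo_sphere q w : dot q q = 1 -> dot (unstereo q w) (unstereo q w) = 1.
Proof.
move=> q1; rewrite /unstereo; set w' := w - _.
have w0 : dot w' w' != 0 by rewrite gt_eqF // dot_gt0 // unstereo_proj_neq0.
have wq : dot w' q = -1 by rewrite /w' dotBl dotZl q1; ring.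
move: w' w0 wq => {w} w w0 wq.
rewrite dotDl dotZl [dot q _]dotC [dot w (_ + _)]dotC !dotDl !dotZl q1 [dot q w]dotC wq.
by field.
Qed.

Lemma unstereo_neq q w : dot q q = 1 -> unstereo q w != q.
Proof.
move=> q1; rewrite /unstereo; set w' := w - _.
have w0 : w' != 0 := unstereo_proj_neq0 w q1.
rewrite -subr_eq0 addrC addKr scaler_eq0 negb_or w0 andbT mulf_neq0 ?invr_neq0 //.
by rewrite gt_eqF // dot_gt0.
Qed.

Lemma stereoK q a : dot a a = 1 -> dot q q = 1 -> a != q -> unstereo q (stereo q a) = a.
Proof.
move=> a1 q1 aq.
have d0 : 1 - dot a q != 0.
  have : 0 < dot (a - q) (a - q) by rewrite dot_gt0 // subr_eq0.
  by rewrite dot_sub_sphere // pmulr_rgt0 // => /lt0r_neq0.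
have sq : dot (stereo q a) q = -1.
  by rewrite /stereo dotZl dotBl q1 -[dot a q - 1]opprB mulrN mulVf //.
rewrite /unstereo sq addNr scale0r subr0.
rewrite [stereo q a in X in _ + X]/stereo scalerA.
suff -> : 2 / dot (stereo q a) (stereo q a) * (1 - dot a q)^-1 = 1.
  by rewrite scale1r addrC subrK.
rewrite /stereo dotZl [dot (a - q) _]dotC dotZl dot_sub_sphere //.
by field.
Qed.

Lemma continuous_unstereo (X : topologicalType) (w : X -> 'rV[R]_4) q :
  dot q q = 1 -> (forall i, continuous (fun x => w x 0 i)) ->
  continuous (fun x => unstereo q (w x)).
Proof.
move=> q1 cw; apply: continuous_mx => k i; rewrite (ord1 k) {k}.
pose w' x := w x - (dot (w x) q + 1) *: q.
have cw' j : continuous (fun x => w' x 0 j).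
  have E x : w' x 0 j = w x 0 j - (dot (w x) q + 1) * q 0 j by rewrite !mxE.
  under eq_fun do rewrite E.
  move=> x; apply: cvgB; first exact: cw.
  apply: cvgM; last exact: cvg_cst.
  apply: cvgD; last exact: cvg_cst.
  by apply: cvg_sum => l; apply: cvgM; [exact: cw|exact: cvg_cst].
have E x : unstereo q (w x) 0 i = q 0 i + 2 / dot (w' x) (w' x) * w' x 0 i.
  by rewrite !mxE.
under eq_fun do rewrite E.
move=> x; apply: cvgD; first exact: cvg_cst.
apply: cvgM; last exact: cw'.
apply: cvgM; first exact: cvg_cst.
apply: cvgV; first by rewrite gt_eqF // dot_gt0 // unstereo_proj_neq0.
by apply: cvg_sum => j; apply: cvgM; exact: cw'.
Qed.

(** The sphere minus q is a hyperplane in stereographic coordinates, and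
    Tietze's theorem extends the coordinates one by one. *)
Lemma sphere_extension N (A : set 'rV[R]_N) (f : 'rV[R]_N -> 'rV[R]_4) q :
  compact A -> {within A, continuous f} -> (forall x, A x -> sphere3 R (f x)) ->
  sphere3 R q -> (forall x, A x -> f x != q) ->
  exists h : 'rV[R]_N -> 'rV[R]_4,
    [/\ continuous h, (forall x, sphere3 R (h x)), (forall x, h x != q)
      & forall x, A x -> h x = f x].
Proof.
move=> cA cf fS /sphere3E q1 fq.
have d0 x : A x -> 1 - dot (f x) q != 0.
  move=> Ax; have : 0 < dot (f x - q) (f x - q) by rewrite dot_gt0 // subr_eq0 fq.
  rewrite dot_sub_sphere //; last exact/sphere3E/fS.
  by rewrite pmulr_rgt0 // => /lt0r_neq0.
have cux i x : A x ->
    stereo q (f y) 0 i @[y --> within A (nbhs x)] --> stereo q (f x) 0 i.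
  move=> Ax.
  have cfx j : f y 0 j @[y --> within A (nbhs x)] --> f x 0 j.
    move/subspace_continuousP: cf => /(_ x Ax) cfx.
    exact: (cvg_comp _ _ cfx (@coord_continuous _ _ _ 0 j (f x))).
  have E y : stereo q (f y) 0 i = (1 - dot (f y) q)^-1 * (f y 0 i - q 0 i).
    by rewrite !mxE.
  under eq_fun do rewrite E.
  rewrite E; apply: cvgM.
    apply: cvgV; first exact: d0.
    apply: cvgB; first exact: cvg_cst.
    apply: cvg_sum => j; apply: cvgM => //; exact: cvg_cst.
  by apply: cvgB => //; exact: cvg_cst.
have cu i : {within A, continuous (fun x => stereo q (f x) 0 i : R^o)}.
  by apply/subspace_continuousP => x Ax; exact: cux.
have /choice[W HW] : forall i, exists W : 'rV[R]_N -> R,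
    continuous W /\ forall x, A x -> W x = stereo q (f x) 0 i.
  move=> i; have [M [_ HM]] := compact_bounded (continuous_compact (cu i) cA).
  have M0 : 0 < `|M| + 1 by rewrite ltr_wpDl.
  have bM x : A x -> `|stereo q (f x) 0 i| <= `|M| + 1.
    move=> Ax; apply: (HM (`|M| + 1)); first by rewrite ltr_pwDr // ler_norm.
    by exists x.
  have clA : closed A by apply: compact_closed => //; exact: norm_hausdorff.
  have [W [WA cW _]] := continuous_bounded_extension
    (pseudometric_normal) clA M0 (cu i) bM.
  by exists W; split=> // x /mem_set /WA.
pose w x : 'rV[R]_4 := \row_i W i x.
have cw i : continuous (fun x => w x 0 i).
  have -> : (fun x => w x 0 i) = W i by apply/funext => x; rewrite mxE.
  by have [] := HW i.
exists (fun x => unstereo q (w x)); split.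
- exact: continuous_unstereo.
- by move=> x; apply/sphere3E/unstereo_sphere.
- by move=> x; apply: unstereo_neq.
- move=> x Ax; have -> : w x = stereo q (f x).
    by apply/rowP=> i; rewrite mxE; have [_ ->] := HW i.
  by apply: stereoK => //; [exact/sphere3E/fS|exact: fq].
Qed.
End Sphere.

(** * Antistars in a sphere are retracts of a simplex *)

Section Realization.
Local Open Scope classical_set_scope.
Local Open Scope ring_scope.
Context {R : realType} {T : finType}.
Implicit Types (L K : {set {set T}}) (s : {set T}) (z : {ptws T -> R}).

(** Tietze's theorem and uniform continuity call for a metric space of points;
    row vectors indexed by T provide one. *)
Definition coords (x : 'rV[R]_#|T|) : {ptws T -> R} := fun v => x 0 (enum_rank v).

Lemma continuous_coord v : continuous (fun x => coords x v).
Proof. exact: coord_continuous. Qed.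

Lemma continuous_coords : continuous coords.
Proof. by apply: continuous_ptws => v; exact: continuous_coord. Qed.

Definition realization_rV L : set 'rV[R]_#|T| := coords @^-1` realization R L.

Lemma realization_le1 L z v : realization R L z -> z v <= 1.
Proof.
by case=> z0 <- _; rewrite (bigD1 v) //= lerDl sumr_ge0 // => u _; exact: z0.
Qed.

Lemma realizationS L K : L \subset K -> realization R L `<=` realization R K.
Proof. by move=> /fintype.subsetP LK z [z0 z1 zL]; split=> //; apply: LK. Qed.

Lemma compact_realization L : simplicial_complex L -> compact (realization_rV L).
Proof.
move=> L_sub; pose cube : set 'rV[R]_#|T| := [set x | forall i, x ord0 i \in `[0, 1]].
have cubeC : compact cube.
  apply: (@rV_compact R #|T| (fun=> `[0 : R, 1]%classic)) => _; exact: segment_compact.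
apply: subclosed_compact cubeC _; last first.
  move=> x xL i; rewrite -[i]enum_valK in_itv /=.
  have := realization_le1 (enum_val i) xL; case: xL => /(_ (enum_val i)).
  by rewrite /coords enum_valK => -> _ _ ->.
(* A support outside L is excluded by the vanishing of the product of its
   coordinates, which is a closed condition. *)
have -> : realization_rV L =
    (\bigcap_v (fun x => coords x v) @^-1` [set t | 0 <= t]) `&`
    ((fun x => \sum_v coords x v) @^-1` [set 1]) `&`
    (\bigcap_(B in [set B | B \notin L]) (fun x => \prod_(v in B) coords x v) @^-1` [set 0]).
  apply/seteqP; split=> x /=.
    move=> [x0 x1 xL]; split; first split=> // v _; first exact: x0.
    move=> B /= BL; apply/eqP; apply: contraNT BL => /prodf_neq0 B0.
    apply: L_sub xL _; apply/fintype.subsetP=> v vB; rewrite inE; exact: B0.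
  move=> [[x0 x1] xL]; split=> // [v|]; first exact: x0.
  apply/negPn/negP => /xL /eqP; apply/negP/prodf_neq0 => v.
  by rewrite inE.
apply: closedI; first apply: closedI.
- apply: closed_bigI => v _; apply: preimage_closed; last exact: closed_ge.
  by move=> x _; exact: continuous_coord.
- apply: preimage_closed; last exact: closed_eq.
  by move=> x _; apply: continuous_sum => v _; exact: continuous_coord.
- apply: closed_bigI => B _; apply: preimage_closed; last exact: closed_eq.
  move=> x _; apply: continuous_big => [|v _]; first exact: mul_continuous.
  exact: continuous_coord.
Qed.

Definition barycenter_pt s : {ptws T -> R} := fun v => (v \in s)%:R / #|s|%:R.

Lemma realization_barycenter K s : simplicial_complex K -> s \in K -> s != finset.set0 ->
  realization R K (barycenter_pt s).
Proof.
move=> K_sub sK s0; have c0 : #|s|%:R != 0 :> R by rewrite pnatr_eq0 cards_eq0.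
split=> [v||]; first by rewrite divr_ge0.
  by rewrite -mulr_suml -natr_sum -big_mkcond /= sum1_card mulfV.
apply: K_sub sK _; apply/fintype.subsetP => v; rewrite inE /barycenter_pt.
by case: (v \in s) => //; rewrite mul0r eqxx.
Qed.

Definition depth s z : R := \big[Num.min/1]_(v in s) z v.

(** The radial push from the barycenter of s, away from the interior of the
    faces containing s: subtract the largest multiple of the indicator of s
    that keeps all the coordinates nonnegative, and renormalize. *)
Definition push s z : {ptws T -> R} :=
  fun v => (z v - depth s z * (v \in s)%:R) / (1 - #|s|%:R * depth s z).

Lemma push_sum s z : \sum_v z v = 1 ->
  \sum_v (z v - depth s z * (v \in s)%:R) = 1 - #|s|%:R * depth s z.
Proof.
move=> z1; rewrite sumrB z1 -mulr_sumr -natr_sum -big_mkcond /= sum1_card.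
by rewrite mulrC.
Qed.

Lemma push_num_ge0 s z v : (forall v, 0 <= z v) ->
  0 <= z v - depth s z * (v \in s)%:R.
Proof.
move=> z0; case vs: (v \in s); rewrite ?mulr0 ?subr0 // mulr1 subr_ge0.
exact: bigmin_le_cond.
Qed.

Lemma depth_attained K s v0 z : realization R K z -> v0 \in s ->
  exists2 v, v \in s & depth s z = z v.
Proof.
move=> zK v0s; rewrite /depth (bigmin_eq_arg _ _ _ _ v0s) => [|v _]; last first.
  exact: realization_le1 zK.
by case: arg_minP => // v vs _; exists v.
Qed.

(** The denominator is the sum of the nonnegative numerators, so it vanishes
    only if z is a multiple of the indicator of s. *)
Lemma push_den_gt0 K s v0 z : realization R K z -> z <> barycenter_pt s -> v0 \in s ->
  0 < 1 - #|s|%:R * depth s z.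
Proof.
move=> [z0 z1 _] zp v0s; have num0 v := push_num_ge0 s v z0.
have := push_sum s z1; rewrite lt0r => <-; rewrite sumr_ge0 // andbT.
apply: contra_notN zp; rewrite psumr_eq0 // => /allP h.
have zE v : z v = depth s z * (v \in s)%:R.
  by apply/eqP; rewrite -subr_eq0; apply: h; rewrite mem_index_enum.
have c0 : #|s|%:R != 0 :> R.
  by rewrite pnatr_eq0 cards_eq0; apply/finset.set0Pn; exists v0.
have d1 : depth s z = #|s|%:R^-1.
  have := z1; rewrite (eq_bigr _ (fun v _ => zE v)) -mulr_sumr -natr_sum.
  rewrite -big_mkcond /= sum1_card => e.
  by apply: (mulIf c0); rewrite e mulVf.
by apply/funext => v; rewrite /barycenter_pt zE d1 mulrC.
Qed.

(** The coordinate at which the minimum is attained becomes 0, so the support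
    no longer contains s. *)
Lemma push_antistar K s v0 z : simplicial_complex K ->
  realization R K z -> z <> barycenter_pt s -> v0 \in s ->
  realization R (antistar K s) (push s z).
Proof.
move=> K_sub zK zp v0s; have d0 := push_den_gt0 zK zp v0s.
case: (zK) => z0 z1 suppK; split=> [v||].
- by apply: divr_ge0; [exact: push_num_ge0|exact: ltW].
- by rewrite /push -mulr_suml push_sum // mulfV // gt_eqF.
have sub : [set v | push s z v != 0]%SET \subset [set v | z v != 0]%SET.
  apply/fintype.subsetP => v; rewrite !inE; apply: contraNneq => zv0.
  rewrite /push mulf_eq0; apply/orP; left.
  have := push_num_ge0 s v z0; rewrite zv0 sub0r oppr_ge0 => h.
  rewrite oppr_eq0 eq_le h mulr_ge0 //.
  by have [w _ ->] := depth_attained zK v0s.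
rewrite inE (K_sub _ _ suppK sub) /=.
have [w ws dw] := depth_attained zK v0s.
apply/negP => /fintype.subsetP/(_ w ws); rewrite inE /push dw ws mulr1 subrr.
by rewrite mul0r eqxx.
Qed.

(** A point of the antistar misses a vertex of s, so nothing is subtracted. *)
Lemma push_id K s v0 z : v0 \in s -> realization R (antistar K s) z -> push s z = z.
Proof.
move=> v0s zK; case: (zK) => z0 _; rewrite inE => /andP[_ /subsetPn[w ws]].
rewrite inE negbK => /eqP zw.
have d0 : depth s z = 0.
  apply: le_anti; apply/andP; split; first by rewrite -zw; exact: bigmin_le_cond.
  by have [u _ ->] := depth_attained zK v0s.
by apply/funext => v; rewrite /push d0 mul0r mulr0 !subr0 divr1.
Qed.

Lemma antistar_neq_barycenter K s z : s != finset.set0 ->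
  realization R (antistar K s) z -> z <> barycenter_pt s.
Proof.
move=> s0 [_ _]; rewrite inE => /andP[_ /negP h] e; apply: h.
apply/fintype.subsetP => v vs; rewrite inE e /barycenter_pt vs mul1r invr_eq0.
by rewrite pnatr_eq0 cards_eq0.
Qed.

Lemma continuous_push (X : topologicalType) K s v0 (F : X -> {ptws T -> R}) v :
  (forall v, continuous (fun x => F x v)) -> (forall x, realization R K (F x)) ->
  (forall x, F x <> barycenter_pt s) -> v0 \in s ->
  continuous (fun x => push s (F x) v).
Proof.
move=> cF FK Fp v0s.
have cd : continuous (fun x => depth s (F x)).
  by apply: continuous_bigmin => u _; exact: cF.
move=> x; apply: cvgM.
  apply: cvgB; first exact: cF.
  by apply: cvgM; [exact: cd|exact: cvg_cst].
apply: cvgV; first by rewrite gt_eqF // (push_den_gt0 (FK x) (Fp x) v0s).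
apply: cvgB; first exact: cvg_cst.
by apply: cvgM; [exact: cvg_cst|exact: cd].
Qed.

(** K minus the barycenter of s is homeomorphic to a punctured sphere and
    retracts to the antistar by [push]; since the punctured sphere is an
    absolute extensor, the antistar is a retract even of the full simplex on
    T. *)
Lemma antistar_retract K s : simplicial_3sphere R K -> s \in K -> s != finset.set0 ->
  exists rho : 'rV[R]_#|T| -> {ptws T -> R},
    [/\ forall v, continuous (fun x => rho x v),
        forall x, realization R (antistar K s) (rho x)
      & forall x, realization_rV (antistar K s) x -> rho x = coords x].
Proof.
move=> [K_sub [f [g [fK gS fg gf [cf cg]]]]] sK s0.
have /finset.set0Pn[v0 v0s] := s0.
have LK : antistar K s \subset K by apply/fintype.subsetP => A; rewrite inE => /andP[].
pose p := barycenter_pt s.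
have pK : realization R K p by exact: realization_barycenter.
have fS z : realization R K z -> sphere3 R (f z) by move=> zK; apply: fK; exists z.
have gK y : sphere3 R y -> realization R K (g y) by move=> yS; apply: gS; exists y.
have inK x : realization_rV (antistar K s) x -> realization R K (coords x).
  exact: realizationS LK _.
have cfL : {within realization_rV (antistar K s), continuous (f \o coords)}.
  exact: within_continuous_comp continuous_coords inK cf.
have fp x : realization_rV (antistar K s) x -> f (coords x) != f p.
  move=> xL; apply/eqP => e; apply: (antistar_neq_barycenter s0 xL).
  by rewrite -[coords x]fg ?in_setE; [rewrite e fg ?in_setE|exact: inK].
(* Extend the embedding of the antistar in the sphere punctured at the image of
   the barycenter, return to the realization of K by g, and push off s. *)
have [h [ch hS hq hE]] := sphere_extension
  (compact_realization (antistar_complex K_sub (s := s))) cfL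
  (fun x xL => fS _ (inK x xL)) (fS _ pK) fp.
have cgh v : continuous (fun x => g (h x) v).
  have cG := continuous_within_comp ch hS cg.
  move=> x; exact: (cvg_comp _ _ (cG x) (@proj_continuous T (fun=> R) v (g (h x)))).
have ghp x : g (h x) <> p.
  by move=> e; have := hq x; rewrite -e gf ?in_setE ?eqxx //; exact: hS.
exists (fun x => push s (g (h x))); split=> [v|x|x xL].
- by apply: continuous_push v0s => // x; exact: gK.
- by apply: push_antistar v0s => //; exact: gK.
- rewrite hE //= fg ?in_setE; last exact: inK.
  exact: push_id v0s xL.
Qed.

End Realization.

(** * Retracts of a simplex have as many even as odd faces *)

Section Mesh.
Local Open Scope classical_set_scope.
Local Open Scope ring_scope.
Context {R : realType} {N : nat}.
Implicit Types (s w t : seq 'rV[R]_N) (x y z : 'rV[R]_N).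

Lemma sum_const_seq (I : Type) (r : seq I) (a : R) :
  \sum_(x <- r) a = (size r)%:R * a.
Proof. by rewrite big_const_seq count_predT iter_addr addr0 mulr_natl. Qed.

Definition average s : 'rV[R]_N := (size s)%:R^-1 *: \sum_(x <- s) x.

Lemma average_dist s z i c : s != [::] ->
  (forall x, x \in s -> `|z 0 i - x 0 i| <= c) -> `|z 0 i - average s 0 i| <= c.
Proof.
move=> s0 sc; have t0 : 0 < (size s)%:R :> R by rewrite ltr0n lt0n size_eq0.
have -> : z 0 i - average s 0 i = (size s)%:R^-1 * \sum_(x <- s) (z 0 i - x 0 i).
  rewrite mxE summxE sumrB mulrBr; congr (_ - _).
  by rewrite sum_const_seq mulKf // gt_eqF.
rewrite normrM gtr0_norm ?invr_gt0 // ler_pdivrMl //.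
apply: le_trans (ler_norm_sum _ _ _) _; rewrite big_seq.
apply: le_trans (ler_sum _ (fun x xs => sc x xs)) _.
by rewrite -big_seq sum_const_seq mulrC.
Qed.

Lemma subdivide_convex (P : 'rV[R]_N -> Prop) s w :
  (forall t, t != [::] -> (forall x, x \in t -> P x) -> P (average t)) ->
  (forall x, x \in s -> P x) -> w \in subdivide average s -> forall x, x \in w -> P x.
Proof.
move=> P_avg; have [n] := ubnP (size s); elim: n s w => // n IH s w ltsn Ps.
have [->|s0] := eqVneq s [::]; first by rewrite subdivide_nil inE => /eqP-> ?.
rewrite subdivide_neq0 // => /flatten_mapP[t ts /mapP[u ut ->]] x.
rewrite inE => /orP[/eqP->|]; first exact: P_avg.
apply: (IH t u _ _ ut); first by rewrite (size_deletions ts).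
by move=> y /(mem_deletions ts); exact: Ps.
Qed.

Lemma subdivide_iter_convex (P : 'rV[R]_N -> Prop) k s w :
  (forall t, t != [::] -> (forall x, x \in t -> P x) -> P (average t)) ->
  (forall x, x \in s -> P x) -> w \in subdivide_iter average k s -> forall x, x \in w -> P x.
Proof.
move=> P_avg; elim: k s => [|k IH] s Ps /=; first by rewrite inE => /eqP->.
by case/flatten_mapP=> u us; apply: IH; exact: subdivide_convex us.
Qed.

Definition diam_le (d : R) s :=
  forall x y i, x \in s -> y \in s -> `|x 0 i - y 0 i| <= d.

(** One of the terms of the average is at distance 0 from x, whence the
    contraction factor. *)
Lemma average_mem_dist n d s x i : (size s <= n.+1)%N -> diam_le d s -> x \in s ->
  `|average s 0 i - x 0 i| <= n%:R / n.+1%:R * d.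
Proof.
move=> sn sd_d xs.
have d0 : 0 <= d by apply: le_trans (sd_d x x i xs xs).
have t0 : 0 < (size s)%:R :> R by rewrite ltr0n lt0n size_eq0; apply: contraTneq xs => ->.
have -> : average s 0 i - x 0 i = (size s)%:R^-1 * \sum_(y <- s) (y 0 i - x 0 i).
  rewrite mxE summxE sumrB mulrBr; congr (_ - _).
  by rewrite sum_const_seq mulKf // gt_eqF.
rewrite (big_rem x) //= subrr add0r normrM gtr0_norm ?invr_gt0 //.
have sumle : `|\sum_(y <- rem x s) (y 0 i - x 0 i)| <= d * (size s).-1%:R.
  apply: le_trans (ler_norm_sum _ _ _) _; rewrite big_seq.
  apply: (@le_trans _ _ (\sum_(y <- rem x s | y \in rem x s) d)).
    by apply: ler_sum => y /mem_rem ys; exact: sd_d.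
  by rewrite -big_seq sum_const_seq size_rem // mulrC.
apply: le_trans (ler_wpM2l _ sumle) _; first by rewrite invr_ge0 ltW.
rewrite mulrCA [leRHS]mulrC ler_wpM2l //.
rewrite mulrC ler_pdivrMr // mulrAC ler_pdivlMr ?ltr0n // -!natrM ler_nat.
by move: sn t0; rewrite ltr0n; case: (size s) => // m mn _ /=; lia.
Qed.

(** The standard mesh estimate, with the factor of the largest dimension used
    for all of them. *)
Lemma subdivide_diam n d s w : 0 <= d -> (size s <= n.+1)%N -> diam_le d s ->
  w \in subdivide average s -> diam_le (n%:R / n.+1%:R * d) w.
Proof.
move=> d0; have [m] := ubnP (size s); elim: m s w => // m IH s w ltsm sn sd_d.
have [->|s0] := eqVneq s [::]; first by rewrite subdivide_nil inE => /eqP-> ?.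
rewrite subdivide_neq0 // => /flatten_mapP[t ts /mapP[u ut ->]].
have c0 : 0 <= n%:R / n.+1%:R * d by rewrite mulr_ge0 // divr_ge0.
have ud : diam_le (n%:R / n.+1%:R * d) u.
  apply: IH ut; first by rewrite (size_deletions ts).
    by apply: leq_trans sn; rewrite -(size_deletions ts).
  by move=> x y i xt yt; apply: sd_d; apply: (mem_deletions ts).
have bu y i : y \in u -> `|average s 0 i - y 0 i| <= n%:R / n.+1%:R * d.
  move: y; apply: (subdivide_convex _ _ ut) => [r r0 rP|x xt].
    exact: average_dist.
  by apply: average_mem_dist => //; apply: (mem_deletions ts).
move=> x y i; rewrite !inE => /orP[/eqP->|xu] /orP[/eqP->|yu].
- by rewrite subrr normr0.
- exact: bu.
- by rewrite distrC; exact: bu.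
- exact: ud.
Qed.

Lemma subdivide_iter_diam n d k s w : 0 <= d -> (size s <= n.+1)%N -> diam_le d s ->
  w \in subdivide_iter average k s -> diam_le ((n%:R / n.+1%:R) ^+ k * d) w.
Proof.
elim: k d s => [|k IH] d s d0 sn sd_d /=.
  by rewrite inE => /eqP->; rewrite expr0 mul1r.
case/flatten_mapP=> u us wu; rewrite exprSr -mulrA.
apply: IH wu; first by rewrite mulr_ge0 // divr_ge0.
  by rewrite (size_subdivide us).
exact: subdivide_diam us.
Qed.

Lemma mesh_small n (e : R) : 0 < e -> exists k, (n%:R / n.+1%:R) ^+ k < e.
Proof.
move=> e0; have c1 : `|n%:R / n.+1%:R : R| < 1.
  by rewrite ger0_norm ?divr_ge0 // ltr_pdivrMr ?ltr0n // mul1r ltr_nat.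
have /cvgrPdist_lt/(_ e e0)[k _ /(_ k (leqnn k))] := cvg_expr c1.
rewrite sub0r normrN /= => h; exists k; apply: le_lt_trans h.
exact: ler_norm.
Qed.
End Mesh.

Section Parity.
Local Open Scope classical_set_scope.
Local Open Scope ring_scope.
Context {R : realType} {T : finType} (L : {set {set T}}).
Hypothesis L_sub : simplicial_complex L.
Variable rho : 'rV[R]_#|T| -> {ptws T -> R}.
Hypothesis rho_cont : forall v, continuous (fun x => rho x v).
Hypothesis rho_L : forall x, realization R L (rho x).
Hypothesis rho_id : forall x, realization_rV L x -> rho x = coords x.
Variable o : T.

Let phi x := [arg max_(v > o) rho x v]%O.

Let rho_phi_ge x : #|T|%:R^-1 <= rho x (phi x).
Proof.
have T0 : 0 < #|T|%:R :> R by rewrite ltr0n; apply/card_gt0P; exists o.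
rewrite -[_^-1]mul1r ler_pdivrMr // mulr_natr -sumr_const.
have [_ rho1 _] := rho_L x; rewrite -[leLHS]rho1; apply: ler_sum => v _.
by rewrite /phi; case: arg_maxP => // w _; apply.
Qed.

Definition vertex_pt v : 'rV[R]_#|T| := delta_mx 0 (enum_rank v).

Lemma coords_vertex u v : coords (vertex_pt u) v = (v == u)%:R.
Proof. by rewrite /coords mxE eqxx (inj_eq enum_rank_inj). Qed.

Definition simplex_complex (A : {set T}) : {set {set T}} := [set B : {set T} | B \subset A]%SET.

Lemma realization_vertex (A : {set T}) v : v \in A -> realization_rV (simplex_complex A) (vertex_pt v).
Proof.
move=> vA; split=> [u||].
- by rewrite coords_vertex.
- under eq_bigr do rewrite coords_vertex.
  by rewrite (bigD1 v) //= eqxx big1 ?addr0 // => u /negPf->.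
- rewrite inE; apply/fintype.subsetP => u; rewrite inE coords_vertex.
  by case: (eqVneq u v) => [->|_]; rewrite ?eqxx.
Qed.

Lemma realization_average (A : {set T}) (t : seq 'rV[R]_#|T|) : t != [::] ->
  (forall x, x \in t -> realization_rV (simplex_complex A) x) -> realization_rV (simplex_complex A) (average t).
Proof.
move=> t0 tA; have t0' : (size t)%:R != 0 :> R by rewrite pnatr_eq0 size_eq0.
have E v : coords (average t) v = (size t)%:R^-1 * \sum_(x <- t) coords x v.
  by rewrite /coords /average mxE summxE.
split=> [v||].
- rewrite E mulr_ge0 ?invr_ge0 // big_seq sumr_ge0 // => x xt.
  by have [+ _ _] := tA x xt; exact.
- under eq_bigr do rewrite E.
  rewrite -mulr_sumr exchange_big /= big_seq.
  rewrite (eq_bigr (fun=> 1)) => [|x xt]; last by have [] := tA x xt.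
  by rewrite -big_seq sum_const_seq mulr1 mulVf.
- rewrite inE; apply/fintype.subsetP => v; rewrite inE E.
  apply: contraNT => vA; rewrite big_seq big1 ?mulr0 // => x xt.
  apply/eqP; have [_ _] := tA x xt; rewrite inE => /fintype.subsetP/(_ v).
  by rewrite inE; move=> h; apply: contraNT vA => /h.
Qed.

(** Label each point x by a vertex at which the coordinate of [rho x] is
    largest. On L, where [rho] is the identity, the label belongs to the
    support of x; and by uniform continuity the cells of a fine subdivision
    are labelled by faces of L. *)
Lemma retract_parity : #|faces_of_parity L true| = #|faces_of_parity L false|.
Proof.
have T0 : 0 < #|T|%:R :> R by rewrite ltr0n; apply/card_gt0P; exists o.
have simplexS s k w x : w \in subdivide_iter average k (map vertex_pt s) -> x \in w ->
    realization_rV (simplex_complex [set v in s]%SET) x.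
  move=> ws; apply: (subdivide_iter_convex _ _ ws) => [t|_ /mapP[v vs ->]].
    exact: realization_average.
  by apply: realization_vertex; rewrite inE.
have compT : compact (realization_rV (R := R) (simplex_complex [set: T]%SET)).
  by apply: compact_realization => F G _ _; rewrite inE finset.subsetT.
have Tinv : 0 < #|T|%:R^-1 :> R by rewrite invr_gt0.
(* Points of one cell of the subdivision have images at distance less than
   1 / #|T|, so that the coordinate selected at each of them is positive at the
   image of any other one. *)
have [d d0 rho_unif] := uniform_continuity compT rho_cont Tinv.
have [k kd] := mesh_small #|T| d0.
apply: acyclic_parity => //.
apply: (@fine_labelling_acyclic T _ L average vertex_pt phi k o) => //.
- move=> A w x AL wA xw.
  have xA := simplexS _ _ _ _ wA xw.
  have xL : realization_rV L x.
    case: xA => x0 x1; rewrite inE => xA; split=> //.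
    apply: L_sub AL _; apply: fintype.subset_trans xA _.
    by apply/fintype.subsetP=> v; rewrite inE mem_enum.
  have := lt_le_trans Tinv (rho_phi_ge x); rewrite (rho_id xL).
  case: xA => _ _; rewrite inE => /fintype.subsetP/(_ (phi x)).
  by rewrite !inE mem_enum => h /lt0r_neq0 /h.
- move=> s w sT ws.
  have wd x y i : x \in w -> y \in w -> `|x 0 i - y 0 i| < d.
    move=> xw yw; apply: le_lt_trans kd.
    rewrite -[leRHS]mulr1; apply: subdivide_iter_diam ws _ _ _ xw yw => //.
      by rewrite size_map.
    move=> u v j /mapP[a _ ->] /mapP[b _ ->].
    rewrite -[j]enum_valK -/(coords _ _) -/(coords (vertex_pt b) _) !coords_vertex.
    by do 2!case: (_ == _); rewrite ?subrr ?subr0 ?sub0r ?normrN ?normr0 ?normr1.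
  case: w ws wd => [|x0 w'] ws wd.
    have [_ _ vL] := rho_L (vertex_pt o); apply: L_sub vL _.
    by apply/fintype.subsetP => v; rewrite inE.
  have [_ _ x0L] := rho_L x0; apply: L_sub x0L _.
  apply/fintype.subsetP => v; rewrite inE => /mapP[x xw ->]; rewrite inE.
  have x0T : realization_rV (simplex_complex [set: T]%SET) x0.
    have := simplexS _ _ _ x0 ws (mem_head _ _); apply: realizationS.
    by apply/fintype.subsetP => B; rewrite !inE finset.subsetT.
  have /(rho_unif x0 x (phi x) x0T) : forall i, `|x0 0 i - x 0 i| < d.
    by move=> i; apply: wd => //; exact: mem_head.
  have := rho_phi_ge x; case: eqP => // ->.
  rewrite sub0r normrN ltr_norml => h /andP[_ /lt_le_trans/(_ h)].
  by rewrite ltxx.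
Qed.
End Parity.

(** * Zero-one matrices of order four *)

(** The expansion of a determinant along its first two rows, which keeps the
    evaluation over all the zero-one matrices cheap. *)
Definition laplace {R : comNzRingType} (a : nat -> nat -> R) : R :=
  let m r i j := a r i * a r.+1 j - a r j * a r.+1 i in
  m 0 0 1 * m 2 2 3 - m 0 0 2 * m 2 1 3 + m 0 0 3 * m 2 1 2
         + m 0 1 2 * m 2 0 3 - m 0 1 3 * m 2 0 2 + m 0 2 3 * m 2 0 1.

Lemma det_laplace (R : comNzRingType) (A : 'M[R]_4) (a : nat -> nat -> R) :
  (forall i j : 'I_4, A i j = a i j) -> \det A = laplace a.
Proof.
move=> Aa; rewrite /laplace /=.
rewrite (expand_det_row _ ord0) !big_ord_recl big_ord0 /cofactor.
rewrite !(expand_det_row _ ord0) !big_ord_recl !big_ord0 /cofactor.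
rewrite !(expand_det_row _ ord0) !big_ord_recl !big_ord0 /cofactor !det_mx11.
rewrite !mxE !Aa /= /bump /=.
ring.
Qed.

Definition lift01 (x : 'F_2) : int := (x : nat)%:Z.

Lemma lift01K (x : 'F_2) : (lift01 x)%:~R = x.
Proof. by rewrite /lift01 -pmulrn natr_Zp. Qed.

Lemma map_lift01K m n (A : 'M['F_2]_(m, n)) : map_mx intr (map_mx lift01 A) = A.
Proof. by apply/matrixP=> i j; rewrite !mxE lift01K. Qed.

(** The 0/1 lift of a matrix invertible modulo 2 has an odd determinant, which
    is at most 3 in absolute value; these are the matrices for which it is 3
    or -3. *)
Definition nonunimodular : {set 'M['F_2]_4} :=
  [set M | (M \in unitmx) && (map_mx lift01 M \notin unitmx)].

Fixpoint lists (A : Type) (e : seq A) n :=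
  if n is n'.+1 then [seq x :: l | x <- e, l <- lists e n'] else [:: [::]].

Lemma mem_lists (A : eqType) (e : seq A) n l :
  size l = n -> {subset l <= e} -> l \in lists e n.
Proof.
elim: n l => [|n IH] [|x l] //= [sl] le.
apply: allpairs_f; first by apply: le; rewrite mem_head.
by apply: IH => // y yl; apply: le; rewrite inE yl orbT.
Qed.

Definition entry (c : seq (seq bool)) i j : int := nth false (nth [::] c i) j.
Definition nonunimodular_code (c : seq (seq bool)) :=
  let d := `|laplace (entry c)|%N in odd d && (d != 1%N).

Lemma count_nonunimodular_codes :
  size [seq c <- lists (lists [:: true; false] 4) 4 | nonunimodular_code c] = 120%N.
Proof. by vm_compute. Qed.

(** Lists of Booleans stand for matrices because they evaluate well. *)
Definition code (M : 'M['F_2]_4) : seq (seq bool) :=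
  [seq [seq M i j == 1 | j <- enum 'I_4] | i <- enum 'I_4].

Lemma lift01_bool (x : 'F_2) : lift01 x = (x == 1).
Proof. by case: x => [[|[|]]]. Qed.

Lemma entry_code M (i j : 'I_4) : map_mx lift01 M i j = entry (code M) i j.
Proof.
rewrite mxE /entry /code (nth_map ord0) ?size_enum_ord // (nth_map ord0) ?size_enum_ord //.
by rewrite !nth_ord_enum lift01_bool.
Qed.

Lemma code_inj : injective code.
Proof.
move=> M N eMN; apply/matrixP=> i j.
have := entry_code M i j; rewrite eMN -entry_code !mxE.
by rewrite /lift01 => -[/val_inj].
Qed.

Lemma intr_even (d : int) : ~~ odd `|d| -> d%:~R = 0 :> 'F_2.
Proof.
rewrite -dvdn2 => /dvdnP[q dq].
rewrite [d]intEsg dq PoszM !intrM.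
by rewrite -[2%:~R]/(2%:R) pchar_Zp ?mulr0.
Qed.

Lemma card_nonunimodular : (#|nonunimodular| <= 120)%N.
Proof.
rewrite -count_nonunimodular_codes cardE -(size_map code).
apply: uniq_leq_size; first by rewrite map_inj_uniq ?enum_uniq //; apply: code_inj.
move=> _ /mapP[M + ->]; rewrite mem_enum inE => /andP[uM nuM].
rewrite mem_filter; apply/andP; split; last first.
  apply: mem_lists; first by rewrite size_map size_enum_ord.
  move=> _ /mapP[i _ ->]; apply: mem_lists; first by rewrite size_map size_enum_ord.
  by move=> b _; case: b.
have dE : \det (map_mx lift01 M) = laplace (entry (code M)).
  by rewrite (det_laplace (entry_code M)).
rewrite /nonunimodular_code -dE; apply/andP; split.
  move: uM; rewrite unitmxE unitfE -{1}(map_lift01K M) det_map_mx.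
  by apply: contraNT => /intr_even e; apply/eqP.
apply: contraNN nuM => /eqP; rewrite unitmxE.
by case: (\det _) => [[|[]]|[]].
Qed.

Lemma card_unitmx4 :
  #|[set M : 'M['F_2]_4 | M \in unitmx]| = (2 ^ 6 * (1 * 3 * 7 * 15))%N.
Proof.
transitivity #|'GL_4['F_2]%g|; last first.
  by rewrite card_GL // card_Fp //; congr (2 ^ _ * _)%N; rewrite unlock.
rewrite -[RHS](card_imset _ val_inj); apply: eq_card => M; rewrite !inE.
apply/idP/imsetP => [uM|[g _ ->]]; last exact: valP g.
by exists (FinRing.unit _ uM); rewrite ?inE.
Qed.

(** At most 167 * 120 = 20040 of the 20160 elements of GL_4(F_2) are excluded.
    *)
Lemma avoid_nonunimodular (J : finType) (D : {set J}) (P : J -> 'M['F_2]_4) :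
  (forall j, j \in D -> P j \in unitmx) -> (#|D| <= 166)%N ->
  exists M : 'M['F_2]_4, [/\ M \in unitmx, M \notin nonunimodular &
    forall j, j \in D -> P j *m M \notin nonunimodular].
Proof.
move=> uP D166.
pose U := \bigcup_(j in D) [set M | P j *m M \in nonunimodular].
pose B := nonunimodular :|: U.
have cU : (#|U| <= \sum_(j in D) 120)%N.
  apply: (@leq_trans (\sum_(j in D) #|[set M | P j *m M \in nonunimodular]|)%N).
    rewrite /U; elim/big_rec2: _ => [|j m A _ le]; first by rewrite cards0.
    by apply: leq_trans (leq_add (leqnn _) le); rewrite -cardsUI leq_addr.
  apply: leq_sum => j jD; apply: leq_trans card_nonunimodular.
  have inj : {in [set M | P j *m M \in nonunimodular] &, injective (mulmx (P j))}.
    by move=> M N _ _ /(can_inj (mulKmx (uP j jD))).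
  rewrite -(card_in_imset inj); apply/subset_leq_card/subsetP=> _ /imsetP[M + ->].
  by rewrite inE.
have cB : (#|B| < #|[set M : 'M['F_2]_4 | M \in unitmx]|)%N.
  rewrite card_unitmx4; rewrite sum_nat_const in cU.
  have := cardsUI nonunimodular U; have := card_nonunimodular; rewrite -/B.
  move: #|B| #|nonunimodular :&: U| #|nonunimodular| #|U| #|D| cU D166 => b i a u d.
  by rewrite -[(2 ^ 6)%N]/64%N; lia.
have /subsetPn[M uM MB] : ~~ ([set M : 'M['F_2]_4 | M \in unitmx] \subset B).
  by apply: contraTN cB => /subset_leq_card; rewrite -leqNgt.
exists M; move: uM MB; rewrite !inE negb_or => uM /andP[M1 M2].
split=> // j jD; apply: contra M2 => PM; apply/bigcupP; exists j => //.
by rewrite inE.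
Qed.

(** * Characteristic maps *)

Section FamilyBasis.
Context {T : finType} {A : comNzRingType} {n : nat}.
Implicit Types (F : {set T}) (e : T -> 'rV[A]_n).

Lemma sum_indicator F e v : v \in F -> \sum_(u in F) (u == v)%:R *: e u = e v.
Proof.
move=> vF; rewrite (bigD1 v) //= eqxx scale1r big1 ?addr0 // => u /andP[_ /negPf->].
by rewrite scale0r.
Qed.

Lemma family_basis_neq0 F e v : family_basis F e -> v \in F -> e v != 0.
Proof.
move=> [free _] vF; apply/eqP => ev0.
have := free (fun u => (u == v)%:R); rewrite sum_indicator // => /(_ ev0 v vF).
by apply/eqP; rewrite eqxx oner_neq0.
Qed.

Lemma family_basis_inj F e : family_basis F e -> {in F &, injective e}.
Proof.
move=> [free _] v w vF wF evw; apply/eqP; apply: contraT => vw.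
have := free (fun u => (u == v)%:R - (u == w)%:R).
under eq_bigr do rewrite scalerBl.
rewrite sumrB !sum_indicator // evw subrr => /(_ erefl v vF)/eqP.
by rewrite eqxx (negPf vw) subr0 oner_eq0.
Qed.
End FamilyBasis.

Section Bases.
Context {T : finType} (o : T).

Definition vertex (F : {set T}) i := nth o (enum F) i.

(** The number of rows is a parameter, to avoid casts along #|F| = n. *)
Definition label_mx {A : Type} n (F : {set T}) (e : T -> 'rV[A]_n) m : 'M[A]_(m, n) :=
  \matrix_(i, j) e (vertex F i) 0 j.

Lemma sum_vertex (V : nmodType) (F : {set T}) m (g : T -> V) : #|F| = m ->
  \sum_(v in F) g v = \sum_(i < m) g (vertex F i).
Proof. by move=> <-; rewrite cardE -big_enum (big_nth o) big_mkord. Qed.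

Lemma mul_label_mx {A : comNzRingType} n (F : {set T}) (e : T -> 'rV[A]_n) m
    (u : 'rV[A]_m) :
  u *m label_mx F e m = \sum_(i < m) u 0 i *: e (vertex F i).
Proof.
rewrite mulmx_sum_row; apply: eq_bigr => i _; congr (_ *: _).
by apply/rowP=> j; rewrite !mxE.
Qed.

Lemma vertexP (F : {set T}) m (v : T) : #|F| = m -> v \in F ->
  exists i : 'I_m, v = vertex F i.
Proof.
move=> <- vF; have lt : (index v (enum F) < #|F|)%N by rewrite cardE index_mem mem_enum.
by exists (Ordinal lt); rewrite /vertex /= nth_index // mem_enum.
Qed.

Lemma vertex_inj (F : {set T}) m : #|F| = m -> {in gtn m &, injective (vertex F)}.
Proof.
move=> <- i j; rewrite !inE cardE => im jm /eqP.
by rewrite nth_uniq ?enum_uniq // => /eqP.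
Qed.

(** Turns coefficients of the rows of [label_mx] into coefficients indexed by
    T, the form in which [family_basis] expects them. *)
Definition extend {A : nmodType} (F : {set T}) m (u : 'rV[A]_m) (v : T) : A :=
  \sum_(i < m | v == vertex F i) u 0 i.

Lemma extendE {A : nmodType} (F : {set T}) m (u : 'rV[A]_m) (i : 'I_m) :
  #|F| = m -> extend F u (vertex F i) = u 0 i.
Proof.
move=> Fm; rewrite /extend (bigD1 i) //= big1 ?addr0 // => j /andP[/eqP e ji].
case/eqP: ji; apply/val_inj/esym.
by apply: (vertex_inj Fm) => //; rewrite unfold_in /= ltn_ord.
Qed.

Lemma family_basis_unit {A : comUnitRingType} n (F : {set T}) (e : T -> 'rV[A]_n) :
  #|F| = n -> label_mx F e n \in unitmx -> family_basis F e.
Proof.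
move=> Fn uP; split=> [c c0 v /(vertexP Fn)[i ->]|w].
  have : (\row_i c (vertex F i)) *m label_mx F e n = 0.
    rewrite mul_label_mx -[RHS]c0 [RHS](sum_vertex _ Fn).
    by apply: eq_bigr => j _; rewrite mxE.
  move/(congr1 (mulmx^~ (invmx (label_mx F e n)))); rewrite mulmxK // mul0mx.
  by move/rowP/(_ i); rewrite !mxE.
exists (extend F (w *m invmx (label_mx F e n))).
rewrite (sum_vertex _ Fn).
rewrite -[LHS](mulmxKV uP) mul_label_mx; apply: eq_bigr => i _.
by rewrite extendE.
Qed.

Lemma family_basis_card {A : fieldType} n (F : {set T}) (e : T -> 'rV[A]_n) :
  family_basis F e -> #|F| = n /\ label_mx F e n \in unitmx.
Proof.
move=> [free span].
have rF : row_free (label_mx F e #|F|).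
  apply: inj_row_free => u; rewrite mul_label_mx => u0.
  apply/rowP=> i; rewrite mxE -(extendE u i erefl).
  apply: free; last by rewrite /vertex -mem_enum mem_nth // -cardE.
  rewrite (sum_vertex _ erefl) -[RHS]u0; apply: eq_bigr => j _.
  by rewrite extendE.
have fF : row_full (label_mx F e #|F|).
  rewrite -sub1mx; apply/row_subP=> i; have [c ->] := span (row i 1%:M).
  rewrite (sum_vertex _ erefl); apply/submxP; exists (\row_i c (vertex F i)).
  by rewrite mul_label_mx; apply: eq_bigr => j _; rewrite mxE.
have Fn : #|F| = n by move: rF fF; rewrite /row_free /row_full => /eqP -> /eqP.
by split=> //; move: rF; rewrite Fn row_free_unit.
Qed.

(** Lift the values entrywise to 0 and 1 in the basis given by M. On a facet F
    this gives the 0/1 lift of P F *m M, and for suitable M all these lifts,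
    and that of M, are unimodular. *)
Lemma lift_of_few_facets (K : {set {set T}}) (lambdaR : T -> 'rV['F_2]_4) :
  mod2_characteristic_map K lambdaR -> (#|[set F | facet K F]%SET| <= 166)%N ->
  exists lambda : T -> 'rV[int]_4, lift_of K lambdaR lambda.
Proof.
move=> charR K166.
pose P F := label_mx F lambdaR 4.
have [|M [uM gM gP]] := @avoid_nonunimodular _ [set F | facet K F]%SET P _ K166.
  by move=> F; rewrite inE => /charR/family_basis_card[].
have uN : map_mx lift01 M \in unitmx.
  by apply: contraNT gM => nu; rewrite inE uM.
(* The factor on the right restores the basis of the values modulo 2. *)
exists (fun v => map_mx lift01 (lambdaR v *m M) *m invmx (map_mx lift01 M)).
split=> [F FK|v _].
  have [F4 uF] := family_basis_card (charR F FK).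
  apply: family_basis_unit => //.
  set N := label_mx _ _ _.
  have -> : N = map_mx lift01 (P F *m M) *m invmx (map_mx lift01 M).
    apply/matrixP=> i j; rewrite !mxE; apply: eq_bigr => k _; rewrite !mxE.
    by congr (lift01 _ * _); apply: eq_bigr => l _; rewrite mxE.
  rewrite unitmx_mul unitmx_inv uN andbT.
  have := gP F; rewrite !inE => /(_ FK); rewrite unitmx_mul uM andbT.
  by rewrite [P F \in _]uF /= negbK.
apply: (can_inj (mulmxK uM)); rewrite -{3}(map_lift01K M) -map_mxM mulmxKV //.
exact: map_lift01K.
Qed.
End Bases.

(** * Neighborly spheres *)

Section Neighborly.
Context {T : finType} (K : {set {set T}}).

Lemma face_in_facet (A : {set T}) : A \in K -> exists2 F, facet K F & A \subset F.
Proof.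
move=> AK; have [F FK AF] := @maxset_exists T [in K] A AK.
by exists F.
Qed.

Lemma facet_face (F : {set T}) : facet K F -> F \in K.
Proof. by case/maxsetP. Qed.

(** Any two vertices lie in a common facet, so the values of the
    characteristic map are distinct, and they are nonzero. *)
Lemma card_vertices_le15 (lambdaR : T -> 'rV['F_2]_4) : neighborly K ->
  mod2_characteristic_map K lambdaR -> (#|faces_of_size K 1| <= 15)%N.
Proof.
move=> K_nbr charR.
have -> : #|faces_of_size K 1| = #|vertices K|.
  rewrite -[RHS](card_imset _ set1_inj); apply: eq_card => A; rewrite !inE.
  apply/andP/imsetP => [[AK /cards1P[v eA]]|[v + ->]].
    by exists v; rewrite // inE -eA.
  by rewrite inE cards1.
have inj : {in vertices K &, injective lambdaR}.
  move=> v w vK wK evw; have [//|vw] := eqVneq v w.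
  have [F FK /fintype.subsetP vwF] := face_in_facet (K_nbr v w vK wK vw).
  by apply: (family_basis_inj (charR F FK)) => //; apply: vwF; rewrite !inE eqxx ?orbT.
rewrite -(card_in_imset inj).
have <- : #|[set~ (0 : 'rV['F_2]_4)]| = 15%N by rewrite cardsC1 card_mx card_Fp.
apply/subset_leq_card/fintype.subsetP => _ /imsetP[v vK ->]; rewrite !inE.
rewrite inE in vK; have [F FK vF] := face_in_facet vK.
by apply: (family_basis_neq0 (charR F FK)); rewrite -finset.sub1set.
Qed.
End Neighborly.

Lemma sphere_has_nonempty_face (R : realType) (T : finType) (K : {set {set T}}) :
  simplicial_3sphere R K -> exists2 A, A \in K & A != finset.set0.
Proof.
move=> [_ [f [g [_ gS _ _ _]]]].
have /gS[_ z1 zK] : [set g x | x in sphere3 R]%classic (g (delta_mx 0 0)).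
  exists (delta_mx 0 0) => //; rewrite /sphere3 /= (bigD1 0) //= mxE eqxx expr1n.
  by rewrite big1 ?addr0 // => i /negPf i0; rewrite mxE i0 andbF expr0n.
exists [set v | g (delta_mx 0 0) v != 0]%SET => //.
apply: contraT; rewrite negbK => /eqP/setP z0; move: z1; rewrite big1 => [/esym/eqP|v _].
  by rewrite oner_eq0.
by have := z0 v; rewrite !inE => /negbFE/eqP.
Qed.

Lemma antistar_parity (R : realType) (T : finType) (K : {set {set T}}) (s : {set T}) :
  simplicial_3sphere R K -> s \in K -> s != finset.set0 ->
  #|faces_of_parity (antistar K s) true| = #|faces_of_parity (antistar K s) false|.
Proof.
move=> KS sK s0; have /finset.set0Pn[v0 v0s] := s0.
have [rho [rho_cont rho_L rho_id]] := antistar_retract KS sK s0.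
have [K_sub _] := KS.
exact: (retract_parity (antistar_complex K_sub (s := s)) rho_cont rho_L rho_id v0).
Qed.

Theorem corollary3p2 (R : realType) (T : finType) (K : {set {set T}})
    (K_sphere : simplicial_3sphere R K) (K_neighborly : neighborly K) :
  toric_lifting_property K.
Proof.
move=> lambdaR charR; have [K_sub _] := K_sphere.
have [A AK /finset.set0Pn[v0 v0A]] := sphere_has_nonempty_face K_sphere.
have K_pure B : B \in K -> exists2 F, F \in K & B \subset F /\ #|F| = 4.
  move=> /face_in_facet[F FK BF]; exists F; first exact: facet_face.
  by have [F4 _] := family_basis_card v0 (charR F FK).
apply: (lift_of_few_facets v0 charR); apply: (@leq_trans 90) => //.
have K0 : K != finset.set0 by apply/finset.set0Pn; exists A.
apply: leq_trans (card_facets_bound K_sub K_pure _ K0 (card_vertices_le15 K_neighborly charR)).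
  apply/subset_leq_card/fintype.subsetP => F; rewrite !inE => FK.
  by rewrite facet_face //= (family_basis_card v0 (charR F FK)).1.
by move=> s; exact: (antistar_parity K_sphere).
Qed.
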